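(* Let $(M^{2n-1},\xi)$ be a contact manifold, $\mathcal F$ a co-Legendrian foliation on $M$ and $\mathcal G$ the respective Legendrian foliation. Then the canonical projective structure on the leaves of $\mathcal G$ has a reduction to an affine structure.
   Context: All objects are smooth. A contact manifold $(M^{2n-1},\xi)$ is a manifold of dimension $2n-1$ with a completely non-integrable hyperplane distribution $\xi$. A Legendrian foliation is an $(n-1)$-dimensional foliation tangent to $\xi$. An $n$-dimensional foliation $\mathcal F$ is co-Legendrian if it is transverse to $\xi$ and $T\mathcal F\cap\xi$ is integrable; the integral foliation $\mathcal G$ of $T\mathcal F\cap\xi$ is the respective Legendrian foliation. Canonical projective structure on leaves of a Legendrian foliation $\mathcal G$: locally let $p:M\to N^n$ be the projection onto the space of leaves of $\mathcal G$. For $x\in N$ and $G_x=p^{-1}(x)$, the differential $dp$ takes the contact hyperplanes $\xi$ along $G_x$ to hyperplanes in $T_xN$, which gives a map $\varphi:G_x\to\mathbb{P}(T^*_xN)\cong\mathbb{RP}^{n-1}$ (the projective space of hyperplanes in $T_xN$). By the non-integrability of $\xi$, $\varphi$ is a local diffeomorphism, and it endows $G_x$ with a projective structure (an atlas with values in $\mathbb{RP}^{n-1}$ and projective transition maps). A reduction to an affine structure is an atlas of affine charts (values in $\mathbb A^{n-1}$, affine transition maps) that is compatible with the projective structure under the standard inclusion of affine space $\mathbb A^{n-1}=\mathbb{RP}^{n-1}\setminus\mathbb{RP}^{n-2}$ into $\mathbb{RP}^{n-1}$. *)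

(* Defs.v *)
From Stdlib Require Export Relation_Operators.
From HB Require Import structures.
From mathcomp Require Export all_boot all_order all_algebra.
From mathcomp Require Export all_classical all_reals all_analysis.
Export numFieldNormedType.Exports.

Set Implicit Arguments.
Unset Strict Implicit.
Unset Printing Implicit Defensive.

Import Order.TTheory GRing.Theory Num.Theory.
Local Open Scope classical_set_scope.
Local Open Scope ring_scope.

(* Subspaces of R^m are row spaces of matrices and are compared with the %MS
   relations.  Dimension 0 is allowed everywhere. *)

(* ** Smooth maps between open subsets of R^p and R^q *)

Fixpoint Ck_on (R : realType) (p q : nat) (r : nat) (U : set 'rV[R]_p)
    (f : 'rV[R]_p -> 'rV[R]_q) : Prop :=
  match r with
  | 0%N => forall x, U x -> {for x, continuous f}
  | s.+1 => (forall x, U x -> differentiable f x) /\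
            (forall v, Ck_on s U (fun x => 'D_v f x))
  end.

Definition smooth_on (R : realType) (p q : nat) (U : set 'rV[R]_p)
    (f : 'rV[R]_p -> 'rV[R]_q) : Prop :=
  forall r, Ck_on r U f.

(* ** Smooth manifolds *)

(* A chart is a bijection from a subset [dom] of T onto an open subset of R^m;
   the values of [ch_fun] off [dom] and of [ch_inv] off the image are junk.
   T is a bare set: its topology is the one induced by an atlas. *)
Record chart (R : realType) (T : Type) (m : nat) := Chart {
  dom : set T ;
  ch_fun :> T -> 'rV[R]_m ;
  ch_inv : 'rV[R]_m -> T }.

Definition is_chart (R : realType) (T : Type) (m : nat)
    (c : chart R T m) : Prop :=
  (forall x, dom c x -> ch_inv c (c x) = x) /\ open (c @` dom c).

Definition smooth_transition (R : realType) (T : Type) (m : nat)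
    (c d : chart R T m) : Prop :=
  open (c @` (dom c `&` dom d)) /\
  smooth_on (c @` (dom c `&` dom d)) (d \o ch_inv c).

(* the charts of the maximal atlas generated by A *)
Definition admissible (R : realType) (T : Type) (m : nat)
    (A : set (chart R T m)) (c : chart R T m) : Prop :=
  is_chart c /\
  (forall d, A d -> smooth_transition c d /\ smooth_transition d c).

Definition atlas_open (R : realType) (T : Type) (m : nat)
    (A : set (chart R T m)) (U : set T) : Prop :=
  forall c, A c -> open (c @` (U `&` dom c)).

Record manifold (R : realType) (m : nat) := Manifold {
  carrier :> Type ;
  atlas : set (chart R carrier m) ;
  atlas_cover : forall x, exists2 c, atlas c & dom c x ;
  atlas_compat : forall c, atlas c -> admissible atlas c ;
  atlas_hausdorff : forall x y, x <> y -> exists U V,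
    [/\ atlas_open atlas U, atlas_open atlas V, U x, V y & U `&` V = set0] ;
  atlas_second_countable : exists B : nat -> set carrier,
    (forall i, atlas_open atlas (B i)) /\
    (forall U x, atlas_open atlas U -> U x ->
       exists i, B i x /\ B i `<=` U) }.

(* ** Fields of tangent subspaces *)

(* A field D of subspaces D_x of T_x M is given by its expression D c x, a
   subspace of R^m, in every admissible chart c around x; these expressions
   correspond to each other under the differentials of the transition maps. *)
Arguments atlas {R m} m0 : rename.

Definition subspace_field (R : realType) (m : nat) (M : manifold R m) : Type :=
  chart R M m -> M -> 'M[R]_m.

Definition is_subspace_field (R : realType) (m : nat) (M : manifold R m)
    (D : subspace_field M) : Prop :=
  forall (c d : chart R M m) (x : M),
    admissible (atlas M) c -> admissible (atlas M) d ->
    dom c x -> dom d x ->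
    (D d x == D c x *m 'J (d \o ch_inv c) (c x))%MS.

Definition intersect_field (R : realType) (m : nat) (M : manifold R m)
    (D E : subspace_field M) : subspace_field M :=
  fun c x => (D c x :&: E c x)%MS.

Definition transverse (R : realType) (m : nat) (M : manifold R m)
    (D E : subspace_field M) : Prop :=
  forall (c : chart R M m) (x : M), admissible (atlas M) c -> dom c x ->
    row_full (D c x + E c x)%MS.

(* ** Contact structures *)

(* d alpha (u, v) at p for the 1-form alpha = sum_i alpha_i dx_i on R^m; the
   value is a 1 x 1 matrix. *)
Definition ext_deriv (R : realType) (m : nat) (alpha : 'rV[R]_m -> 'rV[R]_m)
    (p u v : 'rV[R]_m) : 'M[R]_1 :=
  v *m ('D_u alpha p)^T - u *m ('D_v alpha p)^T.

(* xi is locally the kernel of a smooth nowhere zero 1-form alpha such that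
   d alpha is nondegenerate on ker alpha. *)
Definition contact_structure (R : realType) (m : nat) (M : manifold R m)
    (xi : subspace_field M) : Prop :=
  is_subspace_field xi /\
  forall (c : chart R M m) (x : M), admissible (atlas M) c -> dom c x ->
    exists (U : set 'rV[R]_m) (alpha : 'rV[R]_m -> 'rV[R]_m),
      [/\ open U, U (c x), U `<=` c @` dom c, smooth_on U alpha &
       forall p, U p ->
         [/\ alpha p != 0,
             (xi c (ch_inv c p) == kermx (alpha p)^T)%MS &
             forall u : 'rV[R]_m, u *m (alpha p)^T = 0 ->
               (forall v : 'rV[R]_m, v *m (alpha p)^T = 0 ->
                  ext_deriv alpha p u v = 0) ->
               u = 0]].

(* ** Foliations *)

(* Balls of 'rV[R]_m are open cubes, so the plaques of a foliated chart are
   connected.  The row space of [pid_mx r] is R^r x 0. *)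
Definition foliated_chart (R : realType) (m : nat) (M : manifold R m) (r : nat)
    (D : subspace_field M) (c : chart R M m) : Prop :=
  [/\ admissible (atlas M) c,
      exists (a : 'rV[R]_m) (e : R), 0 < e /\ c @` dom c = ball a e &
      forall x, dom c x -> (D c x == (pid_mx r : 'M[R]_m))%MS].

(* D is the tangent field of an r-dimensional smooth foliation. *)
Definition foliation (R : realType) (m : nat) (M : manifold R m) (r : nat)
    (D : subspace_field M) : Prop :=
  is_subspace_field D /\
  forall x, exists2 c, foliated_chart r D c & dom c x.

(* Here dim M = 2n - 1 with n = k + 1, that is dim M = k + (k + 1). *)
Definition co_legendrian (R : realType) (k : nat) (M : manifold R (k + k.+1))
    (xi F : subspace_field M) : Prop :=
  [/\ foliation k.+1 F, transverse F xi & foliation k (intersect_field F xi)].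

(* ** Leaves *)

(* In a foliated chart c of a k-dimensional foliation the local projection p
   onto the space of leaves N, an open cube of R^(k+1). *)
Definition leaf_proj (R : realType) (k : nat) (M : manifold R (k + k.+1))
    (c : chart R M (k + k.+1)) (x : M) : 'rV[R]_k.+1 :=
  rsubmx (c x).

Definition same_plaque (R : realType) (k : nat) (M : manifold R (k + k.+1))
    (G : subspace_field M) (x y : M) : Prop :=
  exists c, [/\ foliated_chart k G c, dom c x, dom c y &
                leaf_proj c x = leaf_proj c y].

Definition leaf (R : realType) (k : nat) (M : manifold R (k + k.+1))
    (G : subspace_field M) (x : M) : set M :=
  [set y | clos_refl_trans M (same_plaque G) x y].

Definition plaque_chart (R : realType) (k : nat) (M : manifold R (k + k.+1))
    (c : chart R M (k + k.+1)) (t : 'rV[R]_k.+1) : chart R M k :=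
  {| dom := [set x | dom c x /\ leaf_proj c x = t] ;
     ch_fun := fun x => lsubmx (c x) ;
     ch_inv := fun s => ch_inv c (row_mx s t) |}.

(* The plaques make the set M into a k-dimensional (non separable) manifold,
   the disjoint union of the leaves of G with their leaf topology. *)
Definition plaque_atlas (R : realType) (k : nat) (M : manifold R (k + k.+1))
    (G : subspace_field M) : set (chart R M k) :=
  [set e | exists c t, foliated_chart k G c /\ e = plaque_chart c t].

Definition leaf_chart (R : realType) (k : nat) (M : manifold R (k + k.+1))
    (G : subspace_field M) (L : set M) (a : chart R M k) : Prop :=
  admissible (plaque_atlas G) a /\ dom a `<=` L.

(* ** Affine and projective structures on a leaf *)

(* An atlas of diffeomorphisms from open subsets of L onto open subsets of the
   affine space R^k, with locally affine transition maps. *)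
Definition affine_atlas (R : realType) (k : nat) (M : manifold R (k + k.+1))
    (G : subspace_field M) (L : set M) (A : set (chart R M k)) : Prop :=
  [/\ forall a, A a -> leaf_chart G L a,
      forall x, L x -> exists2 a, A a & dom a x &
      forall a b x, A a -> A b -> dom a x -> dom b x ->
        exists (g : 'M[R]_k) (v : 'rV[R]_k), g \in unitmx /\
          \forall s \near a x, b (ch_inv a s) = s *m g + v].

(* Points of RP^k are given by homogeneous coordinates: nonzero row vectors,
   two of which are the same point when their row spaces coincide.  The group
   PGL acts by right multiplication by invertible matrices. *)
Record proj_map (R : realType) (T : Type) (k : nat) := ProjMap {
  pdom : set T ;
  pfun :> T -> 'rV[R]_k.+1 }.

(* the standard inclusion of the affine space R^k in RP^k, s |-> [1 : s] *)
Definition affine_incl (R : realType) (k : nat) (s : 'rV[R]_k) : 'rV[R]_k.+1 :=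
  (row_mx 1%:M s : 'rV[R]_(1 + k)).

Definition affine_to_proj (R : realType) (T : Type) (k : nat)
    (a : chart R T k) : proj_map R T k :=
  {| pdom := dom a ; pfun := fun x => affine_incl (a x) |}.

(* A diffeomorphism from an open subset of the leaf L onto an open subset of
   RP^k: an injective map which, near each point, is a chart of L when read in
   some affine chart (affine_incl followed by g) of RP^k. *)
Definition proj_chart (R : realType) (k : nat) (M : manifold R (k + k.+1))
    (G : subspace_field M) (L : set M) (psi : proj_map R M k) : Prop :=
  [/\ pdom psi `<=` L,
      forall x, pdom psi x -> psi x != 0,
      forall x y, pdom psi x -> pdom psi y -> (psi x == psi y)%MS -> x = y &
      forall x, pdom psi x -> exists (a : chart R M k) (g : 'M[R]_k.+1),
        [/\ leaf_chart G L a, g \in unitmx, dom a x, dom a `<=` pdom psi &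
            forall y, dom a y -> (psi y == affine_incl (a y) *m g)%MS]].

(* The map phi of the fibres of p = leaf_proj c to the projectivized dual of
   T_(p x) N = R^(k+1): the line of covectors vanishing on the hyperplane
   dp(xi_x).  In the chart c the map dp is rsubmx. *)
Definition phi_line (R : realType) (k : nat) (M : manifold R (k + k.+1))
    (xi : subspace_field M) (c : chart R M (k + k.+1)) (x : M) : 'M[R]_k.+1 :=
  kermx (rsubmx (xi c x))^T.

(* The canonical projective structure of L, as a maximal projective atlas: the
   charts which near each point of their domain differ by a projective
   transformation from the map phi of every local projection p.  Another
   coordinate system on N changes phi_line by a linear map depending only on
   p x, which g absorbs. *)
Definition canonical_proj_structure (R : realType) (k : nat)
    (M : manifold R (k + k.+1)) (xi G : subspace_field M) (L : set M) :
    set (proj_map R M k) :=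
  [set psi | proj_chart G L psi /\
    forall c x, foliated_chart k G c -> dom c x -> pdom psi x ->
      let e := plaque_chart c (leaf_proj c x) in
      exists2 g : 'M[R]_k.+1, g \in unitmx &
        \forall s \near e x,
          (psi (ch_inv e s) == phi_line xi c (ch_inv e s) *m g)%MS].

Definition reduces_to_affine (R : realType) (k : nat)
    (M : manifold R (k + k.+1)) (G : subspace_field M) (L : set M)
    (P : set (proj_map R M k)) : Prop :=
  exists2 A, affine_atlas G L A & forall a, A a -> P (affine_to_proj a).

(* Main.v *)
From HB Require Import structures.
From mathcomp Require Import ring lra.
Require Import Defs.

(** Why the theorem holds.  Let G be the intersection of F and xi, and let p
    be the projection of a foliated chart of G onto its local leaf space N.
    Since G is contained in F and F is integrable, the tangent spaces of F
    are constant along the plaques of G modulo G itself: the image of F under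
    dp is a line l_t of T_t N which depends only on the point t = p(x), and
    not on the point x of the plaque ([foliation_constant_along_plaque]).
    Since F is transverse to xi, the hyperplane dp(xi_x) never contains l_t.
    So the map phi, which sends x to the covector of dp(xi_x) up to scale,
    takes its values in the complement of the hyperplane of covectors that
    vanish on l_t, and this complement is an affine space.  Normalizing the
    covector to take the value 1 on a generator of l_t gives the affine
    coordinates ([exists_adapted]).

    That these coordinates are charts rests on the contact condition.  If
    alpha is a contact form, it has no components along the plaques, and its
    last components beta represent phi.  When the derivative of the class of
    beta in a direction u of the plaque vanishes, the derivative of alpha in
    the direction (u, 0) is a multiple of alpha, so that d alpha ((u, 0), v)
    vanishes for all v in xi, and u = 0 ([contact_covector]).  The inverse
    function theorem [inverse_function], which is proved here for smooth maps
    of R^k, turns this immersion into a diffeomorphism.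

    For two foliated charts around the same point the transition map descends
    to the leaf spaces, and its differential there is constant along the
    plaque ([plaque_transition]).  Hence phi changes by a projective
    transformation, and the line l_t changes accordingly.  Two affine charts
    thus differ by a projective transformation that preserves the hyperplane
    at infinity, that is, by an affine map ([affine_of_projective],
    [adapted_transition]). *)

Set Implicit Arguments.
Unset Strict Implicit.
Unset Printing Implicit Defensive.

Import Order.TTheory GRing.Theory Num.Theory.
Local Open Scope classical_set_scope.
Local Open Scope ring_scope.

(** * Calculus of functions of class C^r *)

(** The recursion of [Ck_on] for maps between arbitrary normed modules: the
    bootstrapping of the inverse function theorem needs real-valued and
    matrix-valued maps as well. *)
Fixpoint Ck (R : realType) (V W : normedModType R) (r : nat) (U : set V)
    (f : V -> W) : Prop :=
  match r with
  | 0%N => forall x, U x -> {for x, continuous f}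
  | s.+1 => (forall x, U x -> differentiable f x) /\
            (forall v, Ck s U (fun x => 'D_v f x))
  end.

Lemma Ck_onE (R : realType) p q r (U : set 'rV[R]_p) (f : 'rV[R]_p -> 'rV[R]_q) :
  Ck_on r U f <-> Ck r U f.
Proof.
elim: r f => [|r IH] f; first by split.
by split=> -[df Df]; split=> // v; apply/IH; exact: Df.
Qed.

Lemma derive_comp (R : realType) (V W W' : normedModType R) (f : V -> W)
  (g : W -> W') x v : differentiable f x -> differentiable g (f x) ->
  'D_v (g \o f) x = 'D_('D_v f x) g (f x).
Proof.
move=> df dg; have dgf := differentiable_comp df dg.
rewrite (deriveE v dgf) (deriveE v df) (deriveE _ dg).
exact: (congr1 (@^~ v) (diff_comp df dg)).
Qed.

Lemma derive_lin (R : realType) (V W W' : normedModType R) (f : V -> W)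
    (L : {linear W -> W'}) x v : continuous L -> differentiable f x ->
  'D_v (L \o f) x = L ('D_v f x).
Proof.
move=> cL df; have dL : differentiable L (f x) by exact: linear_differentiable.
rewrite derive_comp// (deriveE _ dL).
exact: (congr1 (@^~ _) (diff_lin (f x) cL)).
Qed.

Section Ck_theory.
Variables (R : realType) (V : normedModType R).
Implicit Types (W : normedModType R) (U : set V) (r : nat).

Lemma Ck_sub W r U U' (f : V -> W) : U `<=` U' -> Ck r U' f -> Ck r U f.
Proof.
move=> UU'; elim: r f => [|r IH] f /=; first by move=> cf x /UU'; apply: cf.
by move=> [df Df]; split=> [x /UU'|v]; [apply: df|apply: IH (Df v)].
Qed.

(** The C^r condition is a conjunction of conditions at single points; the
    derivatives in it are taken in the ambient space. *)
Lemma Ck_local W r U (f : V -> W) :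
  (forall x, U x -> exists2 U', U' x & Ck r U' f) -> Ck r U f.
Proof.
elim: r f => [|r IH] f H /=; first by move=> x /H[U' U'x]; apply.
split=> [x /H[U' U'x [df _]]|v]; first exact: df.
by apply: IH => x /H[U' U'x [_ Df]]; exists U' => //; apply: Df.
Qed.

Lemma Ck_pred W r U (f : V -> W) : Ck r.+1 U f -> Ck r U f.
Proof.
elim: r f => [|r IH] f; move=> [df Df].
  by move=> x Ux; apply: differentiable_continuous; apply: df.
by split=> // v; apply: IH; exact: Df.
Qed.

Lemma open_near_eq W U (f g : V -> W) x : open U -> U x ->
  (forall y, U y -> f y = g y) -> \near x, f x = g x.
Proof. by move=> oU Ux fg; apply: filterS fg _; apply: open_nbhs_nbhs. Qed.

Lemma near_eq_differentiable W (f g : V -> W) x :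
  (\near x, f x = g x) -> differentiable f x -> differentiable g x.
Proof.
move=> fg df; have [cdf fE] := (diff_locallyP x f).1 df.
have gE : g \o shift x = cst (g x) + 'd f x +o_ 0 id.
  apply/eqaddoP => e e0; have /eqaddoP/(_ e e0) := fE.
  have fg0 : \forall y \near 0, f (y + x) = g (y + x).
    have := fg; rewrite (near_shift 0 x)/=.
    by apply: filterS => y /=; rewrite subr0 addrC.
  rewrite -(nbhs_singleton fg); apply: filterS2 fg0 => y /= fgy.
  by rewrite !fctE /= fgy.
have dgE := diff_unique cdf gE.
by apply/diff_locallyP; rewrite dgE.
Qed.

(** On an open set the derivatives of f and g only see the common values. *)
Lemma Ck_congr W r U (f g : V -> W) : open U ->
  (forall x, U x -> f x = g x) -> Ck r U f -> Ck r U g.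
Proof.
move=> oU; elim: r f g => [|r IH] f g fg /=.
  move=> cf x Ux; rewrite /prop_for /continuous_at -fg//.
  apply: cvg_trans (cf x Ux); apply: near_eq_cvg.
  by apply: (open_near_eq oU).
move=> [df Df]; split=> [x Ux|v].
  by apply: near_eq_differentiable (df x Ux); apply: (open_near_eq oU).
apply: IH (Df v) => x Ux; apply: near_eq_derive.
exact: (open_near_eq oU).
Qed.

Lemma Ck_cst W r U (c : W) : Ck r U (fun _ : V => c).
Proof.
elim: r c => [|r IH] c /=; first by move=> x _; apply: cvg_cst.
split=> [x _|v]; first exact: differentiable_cst.
have -> : (fun x => 'D_v (fun _ : V => c) x) = (fun=> 0); last exact: IH.
by apply/funext => x; apply: derive_cst.
Qed.

Lemma Ck_comp_lin W W' r U (f : V -> W) (L : {linear W -> W'}) : open U ->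
  continuous L -> Ck r U f -> Ck r U (L \o f).
Proof.
move=> oU cL; elim: r f => [|r IH] f /=.
  by move=> cf x Ux; apply: continuous_comp; [exact: cf|exact: cL].
move=> [df Df]; split=> [x Ux|v].
  by apply: differentiable_comp; [exact: df|exact: linear_differentiable].
apply: Ck_congr (IH _ (Df v)) => // x Ux /=.
by rewrite derive_lin//; exact: df.
Qed.

Lemma Ck_add W r U (f g : V -> W) : open U ->
  Ck r U f -> Ck r U g -> Ck r U (fun x => f x + g x).
Proof.
move=> oU; elim: r f g => [|r IH] f g.
  by move=> cf cg x Ux; apply: cvgD; [exact: cf|exact: cg].
move=> [df Df] [dg Dg]; split=> [x Ux|v].
  by apply: differentiableD; [exact: df|exact: dg].
apply: Ck_congr (IH _ _ (Df v) (Dg v)) => // x Ux.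
by rewrite -deriveD//; apply: diff_derivable; [exact: df|exact: dg].
Qed.

Lemma Ck_sum W r U (I : Type) (s : seq I) (f : I -> V -> W) : open U ->
  (forall i, Ck r U (f i)) -> Ck r U (fun x => \sum_(i <- s) f i x).
Proof.
move=> oU Cf; elim: s => [|i s IH].
  by apply: Ck_congr (@Ck_cst _ r U 0) => // x _; rewrite big_nil.
by apply: Ck_congr (Ck_add oU (Cf i) IH) => // x _; rewrite big_cons.
Qed.

Lemma Ck_mul r U (f g : V -> R) : open U ->
  Ck r U f -> Ck r U g -> Ck r U (fun x => f x * g x).
Proof.
move=> oU; elim: r f g => [|r IH] f g.
  by move=> cf cg x Ux; apply: cvgM; [exact: cf|exact: cg].
move=> Cf Cg; have [df Df] := Cf; have [dg Dg] := Cg; split=> [x Ux|v].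
  by apply: differentiableM; [exact: df|exact: dg].
have := Ck_add oU (IH _ _ (Ck_pred Cf) (Dg v)) (IH _ _ (Ck_pred Cg) (Df v)).
apply: Ck_congr => // x Ux.
by rewrite [RHS]deriveM//; apply: diff_derivable; [exact: df|exact: dg].
Qed.

Lemma Ck_prod r U (I : Type) (s : seq I) (f : I -> V -> R) : open U ->
  (forall i, Ck r U (f i)) -> Ck r U (fun x => \prod_(i <- s) f i x).
Proof.
move=> oU Cf; elim: s => [|i s IH].
  by apply: Ck_congr (@Ck_cst R r U 1) => // x _; rewrite big_nil.
by apply: Ck_congr (Ck_mul oU (Cf i) IH) => // x _; rewrite big_cons.
Qed.

Lemma Ck_inv r U (f : V -> R) : open U -> (forall x, U x -> f x != 0) ->
  Ck r U f -> Ck r U (fun x => (f x)^-1).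
Proof.
move=> oU f0; elim: r => [|r IH].
  by move=> cf x Ux; apply: cvgV; [exact: f0|exact: cf].
move=> Cf; have [df Df] := Cf; split=> [x Ux|v].
  by apply: differentiableV; [exact: df|exact: f0].
have Ci := IH (Ck_pred Cf).
have := Ck_mul oU (Ck_mul oU (Ck_mul oU Ci Ci) (Df v)) (@Ck_cst R r U (-1)).
apply: Ck_congr => // x Ux /=.
rewrite [RHS]deriveV; [|exact: f0|by apply: diff_derivable; exact: df].
by rewrite /GRing.scale/= -expr2 -exprVn mulrN1 mulNr.
Qed.

Lemma Ck_coord m n r U (f : V -> 'M[R]_(m, n)) i j : open U ->
  Ck r U f -> Ck r U (fun x => f x i j).
Proof.
move=> oU Cf.
have lin : linear (fun N : 'M[R]_(m, n) => N i j).
  by move=> a A B; rewrite !mxE.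
pose L : {linear 'M[R]_(m, n) -> R} :=
  HB.pack (fun N : 'M[R]_(m, n) => N i j) (GRing.isLinear.Build _ _ _ _ _ lin).
by apply: (Ck_comp_lin (L := L)) Cf => //; exact: coord_continuous.
Qed.

(** A matrix is the sum of its entries times the elementary matrices, so this
    reduces to sums and to composition with linear maps. *)
Lemma Ck_mx m n r U (f : V -> 'M[R]_(m, n)) : open U ->
  (forall i j, Ck r U (fun x => f x i j)) -> Ck r U f.
Proof.
move=> oU Cf.
pose L (A : 'M[R]_(m, n)) := ( *:%R ^~ A : R -> 'M[R]_(m, n)).
have linL A : linear (L A) by move=> a x y; rewrite /L scalerDl -scalerA.
have contL A : continuous (L A) by exact: scalel_continuous.
pose LL A : {linear R -> 'M[R]_(m, n)} :=
  HB.pack (L A) (GRing.isLinear.Build _ _ _ _ _ (linL A)).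
have CL i j : Ck r U (fun x => f x i j *: delta_mx i j : 'M[R]_(m,n)).
  apply: (Ck_comp_lin (L := LL (delta_mx i j))) (Cf i j) => //.
  exact: contL.
have := Ck_sum (index_enum _) oU (fun i => Ck_sum (index_enum _) oU (CL i)).
by apply: Ck_congr => // x _; rewrite [RHS]matrix_sum_delta.
Qed.

End Ck_theory.

Lemma Ck_id (R : realType) (V : normedModType R) r (U : set V) : Ck r U (@id V).
Proof.
case: r => [|r] /=; first by move=> x _; apply: cvg_id.
split=> [x _|v]; first exact: (@ex_diff _ _ _ _ _ _ _ (is_diff_id x)).
have -> : (fun x => 'D_v (@id V) x) = (fun=> v); last exact: Ck_cst.
by apply/funext => x; apply: derive_id.
Qed.

Lemma Ck_mulmx (R : realType) (V : normedModType R) m n p r (U : set V)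
  (f : V -> 'M[R]_(m, n)) (g : V -> 'M[R]_(n, p)) : open U ->
  Ck r U f -> Ck r U g -> Ck r U (fun x => f x *m g x).
Proof.
move=> oU Cf Cg; apply: Ck_mx => // i j.
have C l : Ck r U (fun x => f x i l * g x l j).
  by apply: Ck_mul => //; apply: Ck_coord.
by apply: Ck_congr (Ck_sum (index_enum _) oU C) => // x _; rewrite mxE.
Qed.

Lemma Ck_det (R : realType) (V : normedModType R) n r (U : set V)
  (f : V -> 'M[R]_n) : open U ->
  Ck r U f -> Ck r U (fun x => \det (f x)).
Proof.
move=> oU Cf; apply: Ck_sum => // s.
apply: Ck_mul => //; first exact: Ck_cst.
by apply: Ck_prod => // i; apply: Ck_coord.
Qed.

(** By Cramer's rule the entries of the inverse are quotients of polynomials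
    in the entries. *)
Lemma Ck_invmx (R : realType) (V : normedModType R) n r (U : set V)
  (f : V -> 'M[R]_n) : open U -> (forall x, U x -> f x \in unitmx) ->
  Ck r U f -> Ck r U (fun x => invmx (f x)).
Proof.
move=> oU fu Cf; apply: Ck_mx => // i j.
have C1 : Ck r U (fun x => (\det (f x))^-1).
  apply: Ck_inv => //; last exact: Ck_det.
  by move=> x /fu; rewrite unitmxE unitfE.
have C2 : Ck r U (fun x => cofactor (f x) j i).
  apply: Ck_mul => //; first exact: Ck_cst.
  apply: Ck_det => //; apply: Ck_mx => // i' j'.
  apply: Ck_congr (Ck_coord (lift j i') (lift i j') oU Cf) => // x _.
  by rewrite !mxE.
apply: Ck_congr (Ck_mul oU C1 C2) => // x Ux.
by rewrite /invmx fu// !mxE.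
Qed.

Section composition.
Variables (R : realType) (p : nat).

Lemma derive_rV (W : normedModType R) (f : 'rV[R]_p -> W) x v :
  differentiable f x -> 'D_v f x = \sum_i v 0 i *: 'D_(delta_mx 0 i) f x.
Proof.
move=> df; rewrite (deriveE _ df) {1}(row_sum_delta v) linear_sum.
by apply: eq_bigr => i _; rewrite linearZ/= deriveE.
Qed.

(** Induction on r through the chain rule: the derivative of the composite is
    a sum of products of components of the derivative of f with partial
    derivatives of g taken along f. *)
Lemma Ck_comp_scalar (V : normedModType R) r (U : set V) (U' : set 'rV[R]_p)
  (f : V -> 'rV[R]_p) (g : 'rV[R]_p -> R) : open U ->
  (forall x, U x -> U' (f x)) ->
  Ck r U f -> Ck r U' g -> Ck r U (g \o f).
Proof.
move=> oU fU; elim: r g => [|r IH] g.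
  by move=> cf cg x Ux; apply: continuous_comp; [exact: cf|exact/cg/fU].
move=> Cf [dg Dg]; have [df Df] := Cf; split=> [x Ux|v].
  by apply: differentiable_comp; [exact: df|exact/dg/fU].
have C i : Ck r U (fun x => 'D_v f x 0 i * 'D_(delta_mx 0 i) g (f x)).
  apply: (Ck_mul oU (Ck_coord 0 i oU (Df v))).
  exact: (IH _ (Ck_pred Cf) (Dg _)).
apply: Ck_congr (Ck_sum (index_enum _) oU C) => // x Ux.
have Dgf : differentiable g (f x) by exact/dg/fU.
by rewrite [RHS](derive_comp v (df x Ux) Dgf) [RHS](derive_rV _ Dgf).
Qed.

Lemma Ck_comp (V : normedModType R) m n r (U : set V) (U' : set 'rV[R]_p)
  (f : V -> 'rV[R]_p) (g : 'rV[R]_p -> 'M[R]_(m, n)) : open U -> open U' ->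
  (forall x, U x -> U' (f x)) ->
  Ck r U f -> Ck r U' g -> Ck r U (g \o f).
Proof.
move=> oU oU' fU Cf Cg; apply: Ck_mx => // i j.
by apply: (Ck_comp_scalar (U' := U') (g := fun y => g y i j)) => //; apply: Ck_coord.
Qed.

Lemma Ck_jacobian q r (U : set 'rV[R]_p) (f : 'rV[R]_p -> 'rV[R]_q) :
  open U -> Ck r.+1 U f -> Ck r U (fun x => 'J f x).
Proof.
move=> oU Cf; apply: Ck_mx => // i j.
have [df Df] := Cf.
apply: Ck_congr (Ck_coord 0 j oU (Df (delta_mx 0 i))) => // x Ux.
by rewrite deriveE; [rewrite mxE|exact: df].
Qed.
End composition.

(** * The mean value inequality *)

Section mean_value.
Variables (R : realType).

Lemma mx_norm_coord m n (A : 'M[R]_(m, n)) i j : `|A i j| <= `|A|.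
Proof.
rewrite [leRHS]/Num.Def.normr/= mx_normrE.
exact: (le_bigmax _ (fun ij : 'I_m * 'I_n => `|A ij.1 ij.2|) (i, j)).
Qed.

Lemma mx_norm_le m n (A : 'M[R]_(m, n)) c : 0 <= c ->
  (forall i j, `|A i j| <= c) -> `|A| <= c.
Proof.
move=> c0 Ac; rewrite [leLHS]/Num.Def.normr/= mx_normrE.
by apply: bigmax_le => // -[i j] _; apply: Ac.
Qed.

Lemma mulmx_continuous m n p (B : 'M[R]_(n, p)) :
  continuous (mulmxr B : 'M[R]_(m, n) -> 'M[R]_(m, p)).
Proof.
move=> x; have : Ck 0 setT (fun A : 'M[R]_(m, n) => A *m B).
  by apply: Ck_mulmx; [exact: openT|exact: Ck_id|exact: Ck_cst].
by apply.
Qed.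

(** The one-dimensional mean value theorem, applied to each coordinate of f on
    the segment from y to x; the norm is the maximum of the coordinates. *)
Lemma mean_value_le (V : normedModType R) q (f : V -> 'rV[R]_q) (x y : V) (C : R) :
  0 <= C ->
  (forall t : R, 0 <= t <= 1 -> differentiable f (t *: (x - y) + y) /\
     `|'D_(x - y) f (t *: (x - y) + y)| <= C) ->
  `|f x - f y| <= C.
Proof.
move=> C0 H; apply: mx_norm_le => // i j; rewrite ord1 {i}.
pose g (t : R) : V := t *: (x - y) + y.
pose F (t : R) : R := f (g t) 0 j.
have dg (t : R) : is_diff t g ( *:%R^~ (x - y)).
  have -> : g = *:%R^~ (x - y) + cst y by apply/funext.
  by apply: is_diff_eq; rewrite addr0.
have Dg (t : R) : 'D_1 g t = x - y.
  by rewrite deriveE ?diff_val ?scale1r//; exact: ex_diff.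
have dF (t : R) : 0 <= t <= 1 -> is_derive t 1 F ('D_(x - y) f (g t) 0 j).
  move=> /H[df _].
  have dfg : differentiable (f \o g) t by apply: differentiable_comp => //; exact: ex_diff.
  apply: DeriveDef.
    by apply: diff_derivable; exact: (differentiable_comp dfg (differentiable_coord _ 0 j)).
  have := derive_comp (1 : R) (@ex_diff _ _ _ _ _ _ _ (dg t)) df.
  rewrite Dg => <-; rewrite derive_mx ?mxE//.
  exact: diff_derivable.
have cF : {within `[0, 1], continuous F}.
  by apply: derivable_within_continuous => t /itvP t01; have [] := dF t; rewrite ?t01.
have dF' (t : R) : t \in `]0, 1[ -> is_derive t 1 F ('D_(x - y) f (g t) 0 j).
  by move=> /itvP t01; apply: dF; rewrite !t01.
have [c /itvP c01 E] := MVT_segment ler01 dF' cF.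
have := H c; rewrite !c01 => -[]// _; apply: le_trans.
have -> : (f x - f y) 0 j = 'D_(x - y) f (g c) 0 j.
  by rewrite -[RHS]mulr1 -[X in _ * X](subr0 1) -E /F /g scale1r subrK scale0r add0r !mxE.
exact: mx_norm_coord.
Qed.

End mean_value.

(** * Maps close to the identity *)

(** Joins the complete and the normed structures of matrices, so that the
    Banach fixed point theorem applies to them. *)
HB.instance Definition _ (R : realType) (m n : nat) :=
  Uniform_isComplete.Build 'M[R]_(m, n) cauchy_cvg.

Section near_identity.
Variables (R : realType) (k : nat).
Implicit Types (x y z : 'rV[R]_k) (f : 'rV[R]_k -> 'rV[R]_k).

Lemma half_norm x y : `|x| <= 2^-1 * `|x| + `|y| -> `|x| <= 2 * `|y|.
Proof. by move=> h; lra. Qed.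

Lemma half_norm0 x : `|x| <= 2^-1 * `|x| -> x = 0.
Proof.
move=> h; apply/eqP; rewrite -normr_le0.
have := @half_norm x 0; rewrite normr0 addr0 mulr0; exact.
Qed.

Definition half_contracting (B : set 'rV[R]_k) f :=
  forall x y, B x -> B y -> `|(x - f x) - (y - f y)| <= 2^-1 * `|x - y|.

Lemma half_contracting_expand B f x y : half_contracting B f -> B x -> B y ->
  `|x - y| <= 2 * `|f x - f y|.
Proof.
move=> cf Bx By; apply: half_norm.
have -> : x - y = ((x - f x) - (y - f y)) + (f x - f y).
  by apply/rowP => i; rewrite !mxE; ring.
apply: (le_trans (ler_normD _ _)); rewrite lerD2r.
have <- : x - y = x - f x - (y - f y) + (f x - f y) by apply/rowP => i; rewrite !mxE; ring.
exact: cf.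
Qed.

(** A preimage of y near f x is a fixed point of z |-> z - f z + y, which is a
    contraction of a small closed ball around x. *)
Lemma half_contracting_open B f : open B -> half_contracting B f ->
  open (f @` B).
Proof.
move=> oB cf; rewrite openE => _ [x Bx <-].
have /nbhs_ballP[d /= d0 dB] : nbhs x B by apply: open_nbhs_nbhs.
have d20 : 0 < d / 2 by rewrite divr_gt0.
(* The contraction moves x by at most d / 4 and halves distances, so it maps
   the closed ball C of radius d / 2 to itself. *)
apply/nbhs_ballP; exists (d / 4) => /=; first by rewrite divr_gt0.
move=> y; rewrite -ball_normE/= => yd.
pose C := closed_ball_ Num.norm x (d / 2) : set 'rV[R]_k.
have CB : C `<=` B.
  by move=> z Cz; apply: dB; rewrite -ball_normE/=; move: Cz; rewrite /C/closed_ball_/=; lra.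
pose T z := z - f z + y.
have TC : {homo T : z / C z >-> C z}.
  move=> z Cz; have := cf _ _ Bx (CB z Cz).
  rewrite /C /closed_ball_/= /T in Cz *.
  have -> : x - (z - f z + y) = (x - f x - (z - f z)) + (f x - y).
    by apply/rowP => i; rewrite !mxE; ring.
  have := ler_normD (x - f x - (z - f z)) (f x - y).
  lra.
have [|||z Cz Tz] := @banach_fixed_point R 'rV[R]_k C (mkfun_fun TC).
- exists 2^-1%:nng; split=> [|[a b] [/= Ca Cb]]; first by rewrite /=; lra.
  have -> : T a - T b = a - f a - (b - f b) by apply/rowP => i; rewrite !mxE; ring.
  exact: cf (CB _ Ca) (CB _ Cb).
- exact: closed_closed_ball_.
- by exists x; rewrite /C /closed_ball_/= subrr normr0 ltW.
exists z; first exact: CB.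
have /= Tz' : z = T z := Tz.
by apply/rowP => i; have /rowP/(_ i) := Tz'; rewrite /T !mxE => ?; lra.
Qed.


(** Where the partial derivatives of f are close to the basis vectors, the
    differential of f is close to the identity in operator norm. *)
Lemma derive_near_id U f s : open U -> U s -> Ck 1 U f ->
  (forall v, 'D_v f s = v) ->
  exists2 e, 0 < e & ball s e `<=` U /\
    forall x v, ball s e x -> `|v - 'D_v f x| <= 2^-1 * `|v|.
Proof.
move=> oU Us [df cDf] Ds.
(* The factor k would do for a sum of k terms; k + 1 also covers k = 0. *)
pose c : R := (2 * k.+1%:R)^-1.
have c0 : 0 < c by rewrite invr_gt0 mulr_gt0.
have nD : \forall x \near s, forall i : 'I_k,
    `|delta_mx 0 i - 'D_(delta_mx 0 i) f x| < c.
  apply: (@filter_forall _ _ _ (nbhs s)) => i; have := cDf (delta_mx 0 i) _ Us.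
  by rewrite /prop_for /continuous_at Ds => /cvgrPdist_lt; apply.
have nU : nbhs s U by exact: open_nbhs_nbhs.
have [e e0 He] := (nbhs_ballP s _).1 (filterI nD nU).
exists e => //; split=> [x /He[]//|x v /He[Hx Ux]].
rewrite derive_rV; last exact: df.
rewrite {1}(row_sum_delta v) -sumrB.
apply: (le_trans (ler_norm_sum _ _ _)).
have le1 i : true -> `|v 0 i *: delta_mx 0 i - v 0 i *: 'D_(delta_mx 0 i) f x| <= `|v| * c.
  move=> _; rewrite -scalerBr normrZ.
  by apply: ler_pM => //; [exact: mx_norm_coord|exact/ltW/Hx].
apply: (le_trans (ler_sum _ le1)).
rewrite sumr_const card_ord -mulrnAr mulrC ler_wpM2r// -mulr_natr /c invfM.
rewrite -mulrA ler_piMr// mulrC ler_pdivrMr// mul1r ler_nat.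
exact: leqnSn.
Qed.

Lemma ball_segment (s x y : 'rV[R]_k) e t : ball s e x -> ball s e y ->
  0 <= t <= 1 -> ball s e (t *: (x - y) + y).
Proof.
rewrite -!ball_normE/= => Bx By /andP[t0 t1].
have -> : s - (t *: (x - y) + y) = t *: (s - x) + (1 - t) *: (s - y).
  by apply/rowP => i; rewrite !mxE; ring.
apply: (le_lt_trans (ler_normD _ _)); rewrite !normrZ !ger0_norm ?subr_ge0//.
have [->|tn0] := eqVneq t 0; first by rewrite mul0r subr0 mul1r add0r.
have t_gt0 : 0 < t by rewrite lt_def tn0.
rewrite (_ : e = t * e + (1 - t) * e); last by ring.
by rewrite ltr_leD ?ltr_pM2l// ler_wpM2l ?subr_ge0// ltW.
Qed.

Lemma half_contracting_ball f s e :
  (forall x, ball s e x -> differentiable f x) ->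
  (forall x v, ball s e x -> `|v - 'D_v f x| <= 2^-1 * `|v|) ->
  half_contracting (ball s e) f.
Proof.
move=> df Df x y Bx By.
apply: (mean_value_le (f := fun z => z - f z)) => [|t /andP[t0 t1]].
  by rewrite mulr_ge0.
have Bz : ball s e (t *: (x - y) + y) by apply: ball_segment; rewrite ?t0.
have dz := df _ Bz; split.
  by apply: differentiableB => //; exact: (@ex_diff _ _ _ _ _ _ _ (is_diff_id _)).
have dz' := @diff_derivable _ _ _ f _ (x - y) dz.
have did : derivable id (t *: (x - y) + y) (x - y) by exact: derivable_id.
have := deriveB did dz'.
rewrite derive_id => E.
have -> : 'D_(x - y) (fun z => z - f z) (t *: (x - y) + y) =
    x - y - 'D_(x - y) f (t *: (x - y) + y) by exact: E.
exact: Df.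
Qed.

End near_identity.

(** * The inverse function theorem *)

Section diff_eps.
Variables (R : realType) (V W : normedModType R).

Lemma diff_eps (f : V -> W) x (e : R) : differentiable f x -> 0 < e ->
  \forall y \near x, `|f y - f x - 'd f x (y - x)| <= e * `|y - x|.
Proof.
move=> /diff_locallyP[_ /eqaddoP H] e0; have := H _ e0.
rewrite (near_shift 0 x); apply: filterS => y /=.
by rewrite !fctE /= subr0 addrK opprD addrA.
Qed.

(** A criterion for differentiability by explicit bounds, which avoids the
    calculus of little-o terms in the proof for the inverse function. *)
Lemma eps_diff (f : V -> W) x (L : {linear V -> W}) : continuous L ->
  (forall e : R, 0 < e ->
    \forall y \near x, `|f y - f x - L (y - x)| <= e * `|y - x|) ->
  differentiable f x /\ forall v, 'D_v f x = L v.
Proof.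
move=> cL H.
have E : f \o shift x = cst (f x) + L +o_ 0 id.
  apply/eqaddoP => e e0; have := H _ e0.
  rewrite (near_shift 0 x); apply: filterS => y /=.
  by rewrite !fctE /= subr0 addrK opprD addrA.
have dE := diff_unique cL E.
have df : differentiable f x by apply/diff_locallyP; rewrite dE.
by split=> // v; rewrite deriveE// dE.
Qed.

End diff_eps.

Lemma unitmx_ker0 (R : fieldType) n (A : 'M[R]_n) :
  (forall u : 'rV[R]_n, u *m A = 0 -> u = 0) -> A \in unitmx.
Proof.
move=> H; rewrite -row_free_unit -kermx_eq0; apply/eqP/row_matrixP => i.
by rewrite row0; apply: H; rewrite -row_mul mulmx_ker row0.
Qed.

Section inverse_function.
Variables (R : realType) (k : nat).

(** The local inverse g is 2-Lipschitz because f is expanding up to the factor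
    1/2.  So the error term of f at x is also negligible with respect to
    |f z - f x|, and g is differentiable with the inverse differential.  The
    formula for the differential of g then raises the regularity of g by one
    at each step of an induction. *)
Lemma inverse_near_id (U : set 'rV[R]_k) (f : 'rV[R]_k -> 'rV[R]_k) s :
  open U -> U s -> (forall r, Ck r U f) -> (forall v, 'D_v f s = v) ->
  exists W g, [/\ open W, W s, W `<=` U &
    [/\ forall x, W x -> g (f x) = x,
        forall W', open W' -> W' `<=` W -> open (f @` W') &
        forall r, Ck r (f @` W) g]].
Proof.
move=> oU Us Cf Ds.
have [e e0 [BU HB]] := derive_near_id oU Us (Cf 1%N) Ds.
have oB : open (ball s e) by exact: ball_open.
have df x : ball s e x -> differentiable f x by move=> /BU; have [d _] := Cf 1%N; apply: d.
have fB := half_contracting_ball df HB.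
have expd := half_contracting_expand fB.
have sub W' : W' `<=` ball s e -> half_contracting W' f.
  by move=> W'B x y /W'B Bx /W'B By; apply: fB.
have inj x y : ball s e x -> ball s e y -> f x = f y -> x = y.
  move=> Bx By fxy; apply/eqP; rewrite -subr_eq0 -normr_le0.
  by apply: le_trans (expd _ _ Bx By) _; rewrite fxy subrr normr0 mulr0.
pose g y := xget s [set x | ball s e x /\ f x = y].
have gK x : ball s e x -> g (f x) = x.
  move=> Bx; have [Bg fg] : ball s e (g (f x)) /\ f (g (f x)) = f x.
    by apply: (@xgetPex _ s [set z | ball s e z /\ f z = f x]); exists x.
  exact: inj.
have oimg W' : open W' -> W' `<=` ball s e -> open (f @` W').
  by move=> oW' W'B; apply: half_contracting_open (sub _ W'B).
have ofB : open (f @` ball s e) by exact: oimg.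
have Ju x : ball s e x -> 'J f x \in unitmx.
  move=> Bx; apply: unitmx_ker0 => u; rewrite -deriveEjacobian; last exact: df.
  by move=> Du; apply: half_norm0; have := HB x u Bx; rewrite Du subr0.
have Dg x : ball s e x -> differentiable g (f x) /\
    forall v, 'D_v g (f x) = v *m invmx ('J f x).
  move=> Bx; pose L : {linear 'rV[R]_k -> 'rV[R]_k} := mulmxr (invmx ('J f x)).
  have cL : continuous L by exact: mulmx_continuous.
  have [K K0 LK] := linear_lipschitz cL.
  apply: (eps_diff cL) => c c0.
  have cK : 0 < c / (2 * K) by rewrite divr_gt0// mulr_gt0.
  have nI : nbhs (f x) (f @` ball s e).
    exact: open_nbhs_nbhs (conj ofB (imageP f Bx)).
  have gc : g @ f x --> x.
    apply: (@cvgrPdist_lt _ _ _ _ (nbhs_filter (f x)) g x).2 => d d0.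
    have d20 : 0 < d / 2 by rewrite divr_gt0.
    have nd : nbhs (f x) (ball (f x) (d / 2)) by exact: nbhsx_ballx.
    apply: filterS2 nI nd => _ [z Bz <-]; rewrite -ball_normE/= gK// => fxz.
    by have := expd _ _ Bx Bz; lra.
  have nz := gc _ (diff_eps (df x Bx) cK).
  apply: filterS2 nI nz => _ [z Bz <-] /=; rewrite !gK// => fz.
  have -> : z - x - L (f z - f x) = - L (f z - f x - 'd f x (z - x)).
    rewrite [in RHS]linearB opprB; congr (_ - _).
    by rewrite -deriveE ?deriveEjacobian; [rewrite /= mulmxK ?Ju|exact: df|exact: df].
  rewrite normrN; apply: (le_trans (LK _)).
  apply: (@le_trans _ _ (K * (c / (2 * K) * `|z - x|))).
    by rewrite ler_wpM2l// ltW.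
  have -> : K * (c / (2 * K) * `|z - x|) = c / 2 * `|z - x|.
    by field; rewrite gt_eqF.
  have := expd _ _ Bz Bx => h.
  by rewrite -mulrA ler_pM2l//; lra.
exists (ball s e), g; split=> //; first exact: ballxx.
split=> //; elim=> [|r IH].
  move=> _ [x Bx <-]; apply: differentiable_continuous.
  by have [] := Dg x Bx.
split=> [_ [x Bx <-]|v]; first by have [] := Dg x Bx.
have CJ : Ck r (f @` ball s e) (fun y => v *m invmx ('J f (g y))).
  apply: Ck_mulmx => //; first exact: Ck_cst.
  apply: Ck_invmx => //; first by move=> _ [x Bx <-]; rewrite gK// Ju.
  apply: (Ck_comp (U' := U)) => //.
    by move=> _ [x Bx <-]; rewrite gK//; apply: BU.
  exact: Ck_jacobian.
apply: Ck_congr CJ => // _ [x Bx <-].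
by have [_ ->] := Dg x Bx; rewrite gK.
Qed.

(** Composing f with the inverse of its differential at s reduces to the case
    where this differential is the identity. *)
Theorem inverse_function (U : set 'rV[R]_k) (f : 'rV[R]_k -> 'rV[R]_k) s :
  open U -> U s -> (forall r, Ck r U f) ->
  (forall v, 'D_v f s = 0 -> v = 0) ->
  exists W g, [/\ open W, W s, W `<=` U &
    [/\ forall x, W x -> g (f x) = x,
        forall W', open W' -> W' `<=` W -> open (f @` W') &
        forall r, Ck r (f @` W) g]].
Proof.
move=> oU Us Cf Ds; have df : differentiable f s by have [d _] := Cf 1%N; apply: d.
have Ju : 'J f s \in unitmx.
  by apply: unitmx_ker0 => u; rewrite -deriveEjacobian//; exact: Ds.
pose B := invmx ('J f s); have Bu : B \in unitmx by rewrite unitmx_inv.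
have C r (V : set 'rV[R]_k) (g : 'rV[R]_k -> 'rV[R]_k) (D : 'M[R]_k) : open V ->
    Ck r V g -> Ck r V (fun x => g x *m D).
  by move=> oV Cg; apply: Ck_mulmx => //; exact: Ck_cst.
have [|v|W [g [oW Ws WU [gK oimg Cg]]]] :=
    @inverse_near_id U (fun x => f x *m B) s oU Us.
- by move=> r; exact: C.
- have := derive_lin v (@mulmx_continuous _ 1 k k B) df.
  by move=> E; rewrite [LHS]E (deriveEjacobian _ df) /= mulmxK.
have imgE W' : f @` W' = (fun y => y *m B) @^-1` ((fun x => f x *m B) @` W').
  apply/seteqP; split=> [_ [x W'x <-]|y [x W'x E]]; first by exists x.
  by exists x => //; rewrite -(mulmxK Bu (f x)) E mulmxK.
have oimg' W' : open W' -> W' `<=` W -> open (f @` W').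
  move=> oW' W'W; rewrite imgE; apply: open_comp; last exact: oimg.
  by move=> y _; exact: mulmx_continuous.
exists W, (fun y => g (y *m B)); split=> //; split=> // r.
apply: (Ck_comp (U' := (fun x => f x *m B) @` W)) => //.
- exact: oimg'.
- exact: oimg.
- by move=> _ [x Wx <-]; exists x.
- by apply: C; [exact: oimg'|exact: Ck_id].
Qed.

End inverse_function.

(** * Charts and transition maps *)

Lemma smooth_onP (R : realType) p q (U : set 'rV[R]_p) (f : 'rV[R]_p -> 'rV[R]_q) :
  smooth_on U f <-> forall r, Ck r U f.
Proof. by split=> H r; apply/Ck_onE. Qed.

Lemma open_preimage_on (T T' : topologicalType) (U : set T) (V : set T') (f : T -> T') :
  open U -> open V -> (forall x, U x -> {for x, continuous f}) ->
  open (U `&` f @^-1` V).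
Proof.
move=> oU oV cf; rewrite openE => x [Ux Vfx].
apply: filterI; first exact: open_nbhs_nbhs.
by apply: cf => //; exact: open_nbhs_nbhs.
Qed.

Lemma open_preimage_smooth (R : realType) p q (U : set 'rV[R]_p)
    (V : set 'rV[R]_q) (f : 'rV[R]_p -> 'rV[R]_q) :
  open U -> open V -> smooth_on U f -> open (U `&` f @^-1` V).
Proof. by move=> oU oV sf; apply: open_preimage_on => // x; exact: (sf 0%N). Qed.

Section charts.
Variables (R : realType) (T : Type) (m : nat).
Implicit Types (c d : chart R T m) (A : set (chart R T m)).

Lemma chartK c x : is_chart c -> dom c x -> ch_inv c (c x) = x.
Proof. by move=> [H _]; exact: H. Qed.

Lemma chart_inj c x y : is_chart c -> dom c x -> dom c y -> c x = c y -> x = y.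
Proof. by move=> cc cx cy E; rewrite -(chartK cc cx) E chartK. Qed.

(** Around each point the transition map factors through a chart b of A. *)
Lemma transition_compat A c d :
  (forall x, dom c x -> dom d x -> exists2 b, A b & dom b x) ->
  (forall b, A b -> is_chart b) ->
  admissible A c -> admissible A d -> smooth_transition c d.
Proof.
move=> covA chA [cc cA] [dd dA].
pose O (b : chart R T m) := (c @` (dom c `&` dom b)) `&`
            (b \o ch_inv c) @^-1` (b @` (dom b `&` dom d)).
have oO b : A b -> open (O b).
  move=> Ab; have [[op1 s1] _] := cA _ Ab; have [_ [op2 _]] := dA _ Ab.
  exact: (open_preimage_smooth op1 op2 s1).
have OP b p : A b -> O b p ->
    exists y, [/\ dom c y, dom b y, dom d y & p = c y].
  move=> Ab [[y [cy by_] <-] [z [bz dz]]]; rewrite /= chartK// => zy.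
  by exists y; split=> //; rewrite -(chart_inj (chA _ Ab) bz by_ zy).
have Oc b y : dom c y -> dom b y -> dom d y -> O b (c y).
  by move=> cy by_ dy; split; [exists y|exists y; rewrite //= chartK].
have oc : open (c @` (dom c `&` dom d)).
  rewrite openE => _ [x [cx dx] <-]; have [b Ab bx] := covA x cx dx.
  apply: (@filterS _ _ _ (O b)); last by apply: open_nbhs_nbhs; split; [exact: oO|exact: Oc].
  by move=> p /(OP _ _ Ab)[y [cy _ dy ->]]; exists y.
split=> //; apply/smooth_onP => r; apply: Ck_local => _ [x [cx dx] <-].
have [b Ab bx] := covA x cx dx; exists (O b); first exact: Oc.
have [[op1 s1] _] := cA _ Ab; have [_ [op2 s2]] := dA _ Ab.
have C1 : Ck r (O b) (b \o ch_inv c).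
  by apply: Ck_sub ((smooth_onP _ _).1 s1 r) => p [].
have := Ck_comp (oO _ Ab) op2 (fun p (Op : O b p) => Op.2) C1 ((smooth_onP _ _).1 s2 r).
apply: Ck_congr; first exact: oO.
move=> p /(OP _ _ Ab)[y [cy by_ dy ->]] /=.
by rewrite !chartK//; exact: chA.
Qed.

(** Charts can be changed by diffeomorphisms f between open subsets of R^m,
    with inverse g. *)
Lemma admissible_comp A (e : chart R T m) (W : set 'rV[R]_m) (f g : 'rV[R]_m -> 'rV[R]_m) :
  (forall b, A b -> is_chart b) ->
  admissible A e -> open W -> W `<=` e @` dom e ->
  (forall x, W x -> g (f x) = x) ->
  (forall W', open W' -> W' `<=` W -> open (f @` W')) ->
  (forall r, Ck r W f) -> (forall r, Ck r (f @` W) g) ->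
  admissible A {| dom := [set x | dom e x /\ W (e x)];
                  ch_fun := fun x => f (e x);
                  ch_inv := fun y => ch_inv e (g y) |}.
Proof.
move=> chA [ee eA] oW We gK of_ Cf Cg.
set a := Chart _ _ _.
have aimg (D : set T) : a @` (dom a `&` D) = f @` (W `&` e @` (dom e `&` D)).
  apply/seteqP; split=> [_ [x [[ex Wx] Dx] <-]|_ [p [Wp [x [ex Dx] xp]] <-]].
    by exists (e x) => //; split=> //; exists x.
  by rewrite -xp in Wp *; exists x.
have aimgT : a @` dom a = f @` W.
  have := aimg setT; rewrite !setIT => ->; congr (_ @` _).
  by apply/seteqP; split=> [x []//|x Wx]; split=> //; exact: We.
split.
  split; first by move=> x [ex Wx] /=; rewrite gK// chartK.
  by rewrite aimgT; apply: of_.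
move=> d Ad; have [[op1 s1] [op2 s2]] := eA _ Ad.
have oWd : open (W `&` e @` (dom e `&` dom d)) by exact: openI.
have oa : open (a @` (dom a `&` dom d)).
  by rewrite aimg; apply: of_ => // x [].
have daE : d @` (dom d `&` dom a) =
    (d @` (dom d `&` dom e)) `&` (e \o ch_inv d) @^-1` W.
  apply/seteqP; split.
    move=> _ [x [dx [ex Wx]] <-]; split; first by exists x.
    by move: Wx; rewrite /= chartK//; exact: chA.
  move=> _ [[x [dx ex] <-] Wx]; exists x => //; split=> //; split=> //.
  by move: Wx; rewrite /= chartK//; exact: chA.
split; split=> //.
- apply/smooth_onP => r.
  apply: (Ck_comp (f := g) (g := d \o ch_inv e) oa op1) ((smooth_onP _ _).1 s1 r).
    by rewrite aimg => _ [x [Wx ex] <-]; rewrite gK.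
  by apply: Ck_sub (Cg r); rewrite aimg => _ [x [Wx _] <-]; exists x.
- by rewrite daE; exact: (open_preimage_smooth op2 oW s2).
- apply/smooth_onP => r.
  have oda : open (d @` (dom d `&` dom a)).
    by rewrite daE; exact: (open_preimage_smooth op2 oW s2).
  apply: (Ck_comp (f := e \o ch_inv d) oda oW) (Cf r).
    by rewrite daE => p [].
  by apply: Ck_sub ((smooth_onP _ _).1 s2 r); rewrite daE => p [].
Qed.

End charts.

(** * Functions constant along plaques *)

Section manifold_charts.
Variables (R : realType) (m : nat) (M : manifold R m).
Implicit Types (c d : chart R M m).

Lemma admissible_transition c d :
  admissible (atlas M) c -> admissible (atlas M) d -> smooth_transition c d.
Proof.
apply: transition_compat => [x _ _|b Ab]; first exact: atlas_cover.
by have [] := atlas_compat Ab.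
Qed.

(** The opposite transition map is a local inverse, so by the chain rule the
    differential has trivial kernel. *)
Lemma transition_jacobian_unit c d x :
  admissible (atlas M) c -> admissible (atlas M) d -> dom c x -> dom d x ->
  'J (d \o ch_inv c) (c x) \in unitmx.
Proof.
move=> ac ad cx dx; apply: unitmx_ker0 => u.
have [cc _] := ac; have [cd _] := ad.
have [ocd /smooth_onP/(_ 1%N)[dcd _]] := admissible_transition ac ad.
have [odc /smooth_onP/(_ 1%N)[ddc _]] := admissible_transition ad ac.
have cdx : (c @` (dom c `&` dom d)) (c x) by exists x.
have d1 : differentiable (d \o ch_inv c) (c x) by exact: dcd.
have d2 : differentiable (c \o ch_inv d) ((d \o ch_inv c) (c x)).
  by apply: ddc; exists x; rewrite /= ?chartK.
rewrite -deriveEjacobian// => Du.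
have := derive_comp u d1 d2; rewrite Du derive0 => E.
rewrite -E -[LHS](derive_id (c x) u); apply: near_eq_derive.
apply: (open_near_eq ocd cdx) => _ [y [cy dy] <-] /=.
by rewrite !chartK.
Qed.

End manifold_charts.

Section plaque_constancy.
Variables (R : realType) (k l : nat).
Implicit Types (p q : 'rV[R]_(k + l)).

(** The segment between two points of a plaque in a ball stays in the ball and
    is tangent to the plaque. *)
Lemma constant_along_plaque n (f : 'rV[R]_(k + l) -> 'rV[R]_n) s e p q :
  (forall x, ball s e x -> differentiable f x) ->
  (forall x u, ball s e x -> rsubmx u = 0 -> 'D_u f x = 0) ->
  ball s e p -> ball s e q -> rsubmx p = rsubmx q -> f p = f q.
Proof.
move=> df Df Bp Bq pq; apply/eqP; rewrite -subr_eq0 -normr_le0.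
apply: mean_value_le => // t t01; have Bt := ball_segment Bp Bq t01.
split; first exact: df.
rewrite Df ?normr0// [LHS]linearB.
by apply/eqP; rewrite subr_eq0; apply/eqP.
Qed.

Lemma derive_shift_rV (V W : normedModType R) (f : V -> W) (w x v : V) :
  'D_v (fun y => f (y + w)) x = 'D_v f (x + w).
Proof.
rewrite /derive; set F := (X in lim (X @ _) = _); set G := (X in _ = lim (X @ _)).
by have -> : F = G by apply/funext => h; rewrite /F /G /= addrA.
Qed.

(** By [constant_along_plaque] f is invariant under small translations along
    the plaques, hence so are its derivatives in all directions. *)
Lemma derive_constant_along_plaque n (f : 'rV[R]_(k + l) -> 'rV[R]_n) s e p q v :
  (forall x, ball s e x -> differentiable f x) ->
  (forall x u, ball s e x -> rsubmx u = 0 -> 'D_u f x = 0) ->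
  ball s e p -> ball s e q -> rsubmx p = rsubmx q -> 'D_v f p = 'D_v f q.
Proof.
move=> df Df Bp Bq pq.
have rpq : rsubmx (q - p) = 0.
  by rewrite [LHS]linearB; apply/eqP; rewrite subr_eq0; apply/eqP.
rewrite -[q in RHS](subrK p) [q - p + p]addrC -derive_shift_rV; apply: near_eq_derive.
have ob : open (ball s e) by exact: ball_open.
have cs : {for p, continuous (fun y : 'rV[R]_(k + l) => y + (q - p))}.
  have : Ck 0 setT (fun y : 'rV[R]_(k + l) => y + (q - p)).
    by apply: Ck_add; [exact: openT|exact: Ck_id|exact: Ck_cst].
  by apply.
have np : nbhs p (ball s e) by exact: open_nbhs_nbhs.
have nq : nbhs p ((fun y : 'rV[R]_(k + l) => y + (q - p)) @^-1` ball s e).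
  by apply: cs; rewrite addrC subrK; exact: open_nbhs_nbhs.
apply: filterS2 np nq => y By By'.
apply: (constant_along_plaque df Df By By').
by rewrite [RHS]linearD/= rpq addr0.
Qed.

End plaque_constancy.

(** * Foliated charts *)

Section subspaces.
Variables (F : fieldType).

Lemma eqmx_row_ext m1 m2 n (A : 'M[F]_(m1, n)) (B : 'M[F]_(m2, n)) :
  (forall u : 'rV[F]_n, (u <= A)%MS = (u <= B)%MS) -> (A == B)%MS.
Proof.
move=> AB; apply/andP; split; apply/row_subP => i.
  by rewrite -AB row_sub.
by rewrite AB row_sub.
Qed.

Lemma sub_pid_copid n r (u : 'rV[F]_n) : (r <= n)%N ->
  (u <= (pid_mx r : 'M[F]_n))%MS = (u *m copid_mx r == 0).
Proof.
move=> rn; apply/idP/eqP => [/submxP[w ->]|].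
  by rewrite -mulmxA mul_pid_mx_copid ?mulmx0.
rewrite /copid_mx mulmxBr mulmx1 => /eqP; rewrite subr_eq0 => /eqP {1}->.
exact: submxMl.
Qed.

Lemma sub_pid_rsubmx k l (u : 'rV[F]_(k + l)) :
  (u <= (pid_mx k : 'M[F]_(k + l)))%MS = (rsubmx u == 0).
Proof.
rewrite pid_mx_block; apply/idP/eqP => [/submxP[w ->]|u0].
  by rewrite -[w]hsubmxK mul_row_block !mulmx0 !addr0 row_mxKr.
apply/submxP; exists u; rewrite -{2}[u]hsubmxK mul_row_block mulmx1 !mulmx0 !addr0.
by rewrite -{1}[u]hsubmxK u0.
Qed.

Lemma rsubmx_sub m1 m2 k l (A : 'M[F]_(m1, k + l)) (B : 'M[F]_(m2, k + l)) :
  (A <= B)%MS -> (rsubmx A <= rsubmx B)%MS.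
Proof.
move=> /submxP[D ->]; apply/submxP; exists D.
by rewrite -{1}[B]hsubmxK mul_mx_row row_mxKr.
Qed.

Lemma rsubmx_eqmx m1 m2 k l (A : 'M[F]_(m1, k + l)) (B : 'M[F]_(m2, k + l)) :
  (A == B)%MS -> (rsubmx A == rsubmx B)%MS.
Proof. by move=> /andP[AB BA]; rewrite /eqmx !rsubmx_sub. Qed.

End subspaces.

Lemma rsubmx_mul (F : fieldType) k l n (X : 'M[F]_(n, k + l)) (J : 'M[F]_(k + l)) :
  rsubmx (X *m J) = lsubmx X *m ursubmx J + rsubmx X *m drsubmx J.
Proof. by rewrite -{1}[X]hsubmxK -{1}[J]submxK mul_row_block row_mxKr. Qed.

Lemma rsubmx_mul_ur0 (F : fieldType) k l n (X : 'M[F]_(n, k + l)) (J : 'M[F]_(k + l)) :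
  ursubmx J = 0 -> rsubmx (X *m J) = rsubmx X *m drsubmx J.
Proof. by move=> J0; rewrite rsubmx_mul J0 mulmx0 add0r. Qed.

Section foliation_charts.
Variables (R : realType) (k l : nat) (M : manifold R (k + l)).
Implicit Types (c d : chart R M (k + l)).

Lemma image_ball c d x : admissible (atlas M) c -> admissible (atlas M) d ->
  dom c x -> dom d x ->
  exists2 e : R, 0 < e & ball (c x) e `<=` c @` (dom c `&` dom d).
Proof.
move=> ac ad cx dx; have [ocd _] := admissible_transition ac ad.
have cdx : (c @` (dom c `&` dom d)) (c x) by exists x.
by have [e e0 He] := (nbhs_ballP (c x) _).1 (open_nbhs_nbhs (conj ocd cdx)); exists e.
Qed.

(** The last components of the transition map have zero derivative along the
    plaques, since the differential preserves the tangent field of the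
    foliation.  So they descend to a map of the local leaf spaces; T is the
    differential of this map at the image of x. *)
Lemma plaque_transition (G : subspace_field M) c d x :
  is_subspace_field G -> foliated_chart k G c -> foliated_chart k G d ->
  dom c x -> dom d x ->
  exists (e : R) (T : 'M[R]_l), [/\ 0 < e, T \in unitmx &
    forall p, ball (c x) e p -> rsubmx p = rsubmx (c x) ->
      [/\ (c @` (dom c `&` dom d)) p,
          rsubmx (d (ch_inv c p)) = rsubmx (d x) &
          forall n (X : 'M[R]_(n, k + l)),
            rsubmx (X *m 'J (d \o ch_inv c) p) = rsubmx X *m T]].
Proof.
move=> fG [ac _ Gc] [ad _ Gd] cx dx.
have [e e0 Be] := image_ball ac ad cx dx.
have [cc _] := ac.
have [_ /smooth_onP/(_ 1%N)[dcd _]] := admissible_transition ac ad.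
have dB p : ball (c x) e p -> differentiable (d \o ch_inv c) p by move=> /Be; apply: dcd.
pose f := rsubmx \o (d \o ch_inv c) : 'rV[R]_(k + l) -> 'rV[R]_l.
have df p : ball (c x) e p -> differentiable f p.
  by move=> Bp; apply: differentiable_comp; [exact: dB|exact: differentiable_rsubmx].
have Df p u : ball (c x) e p -> 'D_u f p = rsubmx (u *m 'J (d \o ch_inv c) p).
  move=> Bp; rewrite -deriveEjacobian; last exact: dB.
  exact: derive_lin u (@continuous_rsubmx _ 1 k l) (dB p Bp).
have Df0 p u : ball (c x) e p -> rsubmx u = 0 -> 'D_u f p = 0.
  move=> Bp u0; rewrite Df//; have [y [cy dy] py] := Be p Bp.
  have uG : (u <= G c y)%MS by rewrite (eqmxP (Gc y cy)) sub_pid_rsubmx u0.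
  have := submxMr ('J (d \o ch_inv c) p) uG.
  by rewrite -py -(eqmxP (fG c d y ac ad cy dy)) (eqmxP (Gd y dy)) sub_pid_rsubmx => /eqP.
have Bx : ball (c x) e (c x) by exact: ballxx.
pose J p : 'M[R]_(k + l) := 'J (d \o ch_inv c) p.
have urJ p : ball (c x) e p -> ursubmx (J p) = 0.
  move=> Bp; apply/row_matrixP => i.
  have := Df0 p (row_mx (delta_mx 0 i) 0) Bp (row_mxKr _ _).
  by rewrite Df// rsubmx_mul row_mxKl row_mxKr mul0mx addr0 row0 -rowE.
have drJ p : ball (c x) e p -> rsubmx p = rsubmx (c x) ->
    drsubmx (J p) = drsubmx (J (c x)).
  move=> Bp px; apply/row_matrixP => i.
  pose v : 'rV[R]_(k + l) := row_mx 0 (delta_mx 0 i).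
  have E : rsubmx (v *m J p) = rsubmx (v *m J (c x)).
    apply: etrans (esym (Df p v Bp)) (etrans _ (Df (c x) v Bx)).
    exact: derive_constant_along_plaque df Df0 Bp Bx px.
  have vE (A : 'M[R]_(k + l)) : rsubmx (v *m A) = row i (drsubmx A).
    by rewrite rsubmx_mul row_mxKl row_mxKr mul0mx add0r -rowE.
  exact: etrans (esym (vE _)) (etrans E (vE _)).
exists e, (drsubmx (J (c x))); split=> //.
  have := transition_jacobian_unit ac ad cx dx.
  rewrite !unitmxE -/(J (c x)) -[X in \det X](submxK (J (c x))) urJ//.
  by rewrite det_lblock unitrM => /andP[].
move=> p Bp px; split; first exact: Be.
  rewrite -[RHS](congr1 (fun y => rsubmx (d y)) (chartK cc cx)).
  exact: (constant_along_plaque df Df0 Bp Bx px).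
move=> n X; apply: etrans (rsubmx_mul_ur0 X (urJ p Bp)) _.
exact: (congr1 (mulmx (rsubmx X)) (drJ p Bp px)).
Qed.

(** In a foliated chart of F the field F is the kernel of a constant
    projection.  So in the chart c it is the kernel of the differential of a
    map f which, as F contains G, is constant along the plaques of G. *)
Lemma foliation_constant_along_plaque r (G F : subspace_field M) c x :
  (r <= k + l)%N -> foliation r F -> foliated_chart k G c ->
  (forall y, dom c y -> (G c y <= F c y)%MS) -> dom c x ->
  exists2 e : R, 0 < e & forall p, ball (c x) e p ->
    (c @` dom c) p /\ (rsubmx p = rsubmx (c x) -> (F c (ch_inv c p) == F c x)%MS).
Proof.
move=> rm [fF chF] [ac _ Gc] GF cx; have [d [ad _ Fd] dx] := chF x.
have [e e0 Be] := image_ball ac ad cx dx.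
have [cc _] := ac.
have [_ /smooth_onP/(_ 1%N)[dcd _]] := admissible_transition ac ad.
have dB p : ball (c x) e p -> differentiable (d \o ch_inv c) p by move=> /Be; apply: dcd.
pose L : {linear 'rV[R]_(k + l) -> 'rV[R]_(k + l)} := mulmxr (copid_mx r).
have cL : continuous L by exact: mulmx_continuous.
have dL y : differentiable L y by exact: linear_differentiable.
(* copid_mx r is the projection with kernel R^r x 0. *)
pose f := L \o (d \o ch_inv c) : 'rV[R]_(k + l) -> 'rV[R]_(k + l).
have df p : ball (c x) e p -> differentiable f p.
  by move=> Bp; apply: differentiable_comp; [exact: dB|exact: dL].
have Df p u : ball (c x) e p -> 'D_u f p = u *m 'J (d \o ch_inv c) p *m copid_mx r.
  move=> Bp; rewrite -deriveEjacobian; last exact: dB.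
  exact: derive_lin u cL (dB p Bp).
have FE p u : ball (c x) e p -> (u <= F c (ch_inv c p))%MS = ('D_u f p == 0).
  move=> Bp; rewrite Df//; have [y [cy dy] <-] := Be p Bp; rewrite chartK//.
  have Ju := transition_jacobian_unit ac ad cy dy.
  rewrite -sub_pid_copid// -(eqmxP (Fd y dy)) (eqmxP (fF c d y ac ad cy dy)).
  by rewrite submxMfree// row_free_unit.
have Df0 p u : ball (c x) e p -> rsubmx u = 0 -> 'D_u f p = 0.
  move=> Bp u0; apply/eqP; rewrite -FE//; have [y [cy dy] <-] := Be p Bp.
  rewrite chartK//; apply: submx_trans (GF y cy).
  by rewrite (eqmxP (Gc y cy)) sub_pid_rsubmx u0.
have Bx : ball (c x) e (c x) by exact: ballxx.
exists e => // p Bp; split; first by have [y [cy _] <-] := Be p Bp; exists y.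
have FxE u : (u <= F c x)%MS = ('D_u f (c x) == 0).
  by rewrite -(FE (c x) u Bx) (chartK cc cx).
move=> px; apply: eqmx_row_ext => u; rewrite (FE p u Bp) FxE.
by rewrite (derive_constant_along_plaque u df Df0 Bp Bx px).
Qed.

End foliation_charts.

(** * The leaf topology: plaque charts *)

Section slices.
Variables (R : realType) (k l : nat).

Lemma Ck_row_mx r (t : 'rV[R]_l) :
  Ck r setT (fun s : 'rV[R]_k => row_mx s t : 'rV[R]_(k + l)).
Proof.
have Cl : Ck r setT (fun s : 'rV[R]_k => s *m row_mx 1%:M 0 : 'rV[R]_(k + l)).
  by apply: Ck_mulmx; [exact: openT|exact: Ck_id|exact: Ck_cst].
have := Ck_add openT Cl (@Ck_cst R _ _ r setT (row_mx 0 t)).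
apply: Ck_congr; first exact: openT.
by move=> s _; rewrite mul_mx_row mulmx1 mulmx0 add_row_mx addr0 add0r.
Qed.

Lemma open_slice (U : set 'rV[R]_(k + l)) (t : 'rV[R]_l) :
  open U -> open [set s : 'rV[R]_k | U (row_mx s t)].
Proof.
move=> oU; rewrite (_ : mkset _ = setT `&` (fun s => row_mx s t) @^-1` U); last first.
  by rewrite setTI.
by apply: open_preimage_on; [exact: openT|exact: oU|exact: (Ck_row_mx 0)].
Qed.

End slices.

Section plaques.
Variables (R : realType) (k : nat) (M : manifold R (k + k.+1)).
Variables (G : subspace_field M) (fG : is_subspace_field G).
Implicit Types (c d : chart R M (k + k.+1)).

Lemma plaque_image c t : admissible (atlas M) c ->
  plaque_chart c t @` dom (plaque_chart c t) =
  [set s | (c @` dom c) (row_mx s t)].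
Proof.
move=> [cc _]; apply/seteqP; split=> [_ [x [cx <-] <-]|s [x cx xs]].
  by exists x => //=; rewrite /leaf_proj hsubmxK.
exists x; first by split=> //; rewrite /leaf_proj xs row_mxKr.
by rewrite /= xs row_mxKl.
Qed.

Lemma plaque_is_chart c t : admissible (atlas M) c -> is_chart (plaque_chart c t).
Proof.
move=> ac; have [cc _] := ac; split.
  by move=> x [cx <-] /=; rewrite /leaf_proj hsubmxK chartK.
by rewrite plaque_image//; apply: open_slice; have [] := cc.
Qed.

(** A plaque of d meets a plaque of c in an open subset of the latter, because
    the transition map preserves plaques locally. *)
Lemma plaque_compat c d t t' : foliated_chart k G c -> foliated_chart k G d ->
  smooth_transition (plaque_chart c t) (plaque_chart d t').
Proof.
move=> Gc Gd; have [ac _ _] := Gc; have [ad _ _] := Gd.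
have [cc _] := ac; have [cd _] := ad.
have [ocd scd] := admissible_transition ac ad.
set e := plaque_chart c t; set e' := plaque_chart d t'.
have oe : open (e @` (dom e `&` dom e')).
  rewrite openE => _ [x [[cx xt] [dx xt']] <-].
  have [r [T [r0 _ H]]] := plaque_transition fG Gc Gd cx dx.
  have oB : open [set s : 'rV[R]_k | ball (c x) r (row_mx s t)].
    by apply: open_slice; exact: ball_open.
  have Bx : ball (c x) r (row_mx (e x) t).
    by rewrite /= -xt /leaf_proj hsubmxK; exact: ballxx.
  apply: filterS (open_nbhs_nbhs (conj oB Bx)) => s Bs.
  have [|[y [cy dy] ys] pd _] := H _ Bs; first by rewrite row_mxKr -xt.
  exists y; last by rewrite /= ys row_mxKl.
  split; split=> //; first by rewrite /leaf_proj ys row_mxKr.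
  by rewrite -xt' /leaf_proj -pd -ys (chartK cc cy).
split=> //; apply/smooth_onP => r.
have Cl : Ck r (c @` (dom c `&` dom d))
    (fun p => (d \o ch_inv c) p *m col_mx 1%:M 0 : 'rV[R]_k).
  by apply: Ck_mulmx => //; [exact: (smooth_onP _ _).1 scd r|exact: Ck_cst].
have eU s : (e @` (dom e `&` dom e')) s -> (c @` (dom c `&` dom d)) (row_mx s t).
  by move=> [x [[cx <-] [dx _]] <-]; exists x => //=; rewrite /leaf_proj hsubmxK.
have Cr := Ck_sub (@subsetT _ _) (@Ck_row_mx R k k.+1 r t).
have := Ck_comp oe ocd eU (Cr _) Cl.
apply: Ck_congr => // s _ /=.
by rewrite -{1}[d _]hsubmxK mul_row_col mulmx1 mulmx0 addr0.
Qed.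

Lemma plaque_admissible c t : foliated_chart k G c ->
  admissible (plaque_atlas G) (plaque_chart c t).
Proof.
move=> Gc; have [ac _ _] := Gc; split; first exact: plaque_is_chart.
by move=> _ [d [t' [Gd ->]]]; split; exact: plaque_compat.
Qed.

Lemma plaque_atlas_chart b : plaque_atlas G b -> is_chart b.
Proof. by move=> [c [t [[ac _ _] ->]]]; exact: plaque_is_chart. Qed.

End plaques.

(** * Linear algebra of hyperplanes and covectors *)

Section covectors.
Variable K : fieldType.

(** The double annihilator of the row space of A is this row space. *)
Lemma submx_ker m1 m2 n (A : 'M[K]_(m1, n)) (B : 'M[K]_(m2, n)) :
  (forall v : 'rV[K]_n, v *m A^T = 0 -> v *m B^T = 0) -> (B <= A)%MS.
Proof.
move=> AB; rewrite submxE; apply/eqP/trmx_inj; rewrite trmx_mul trmx0.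
apply/row_matrixP => i; rewrite row_mul row0; apply: AB.
by rewrite -row_mul -trmx_mul mulmx_coker trmx0 row0.
Qed.

Lemma mul_row0_tr n k l (X : 'M[K]_(n, k + l)) (b : 'rV[K]_l) :
  X *m (row_mx 0 b)^T = rsubmx X *m b^T.
Proof. by rewrite -{1}[X]hsubmxK tr_row_mx mul_row_col trmx0 mulmx0 add0r. Qed.

(** For a hyperplane X that contains R^k x 0 the covector of X is that of its
    image in the quotient R^l. *)
Lemma annihilator_rsubmx n k l (X : 'M[K]_(n, k + l)) (b : 'rV[K]_l) :
  (X == kermx (row_mx 0 b : 'rV[K]_(k + l))^T)%MS ->
  (kermx (rsubmx X)^T == b)%MS.
Proof.
move=> /andP[Xk kX]; apply/andP; split.
  apply: submx_ker => v vb; set W := kermx _.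
  have : (row_mx 0 v <= X)%MS.
    by apply: submx_trans kX; rewrite sub_kermx mul_row0_tr row_mxKr vb.
  move=> /rsubmx_sub; rewrite row_mxKr => /submxP[D ->].
  by rewrite -mulmxA -[rsubmx X]trmxK -trmx_mul mulmx_ker trmx0 mulmx0.
rewrite sub_kermx; apply/eqP/trmx_inj; rewrite trmx_mul trmxK trmx0 -mul_row0_tr.
by apply/eqP; rewrite -sub_kermx.
Qed.

(** A is spanned by any vector f outside the hyperplane X and by the
    intersection of A with X, which is killed by the projection to R^l. *)
Lemma line_rsubmx n m k l (A : 'M[K]_(n, k + l)) (X : 'M[K]_(m, k + l)) (b : 'rV[K]_l) :
  b != 0 -> (X == kermx (row_mx 0 b : 'rV[K]_(k + l))^T)%MS ->
  row_full (A + X)%MS -> (A :&: X <= (pid_mx k : 'M[K]_(k + l)))%MS ->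
  exists2 v : 'rV[K]_l, (rsubmx A == v)%MS & v *m b^T != 0.
Proof.
move=> b0 /andP[Xk kX] AX AXk.
have Xb : rsubmx X *m b^T = 0.
  by rewrite -mul_row0_tr; apply/eqP; rewrite -sub_kermx.
have Ab : rsubmx A *m b^T != 0.
  apply/eqP => Ab; have AX' : (A <= X)%MS.
    by apply: submx_trans kX; rewrite sub_kermx mul_row0_tr Ab.
  have Xf : row_full X.
    by rewrite -sub1mx; apply: submx_trans (_ : A + X <= X)%MS;
      rewrite ?sub1mx// addsmx_sub AX' submx_refl.
  have : (row_mx 0 b : 'rV[K]_(k + l)) != 0.
    by apply: contra b0 => /eqP/(congr1 rsubmx); rewrite row_mxKr linear0 => ->.
  apply/negP; rewrite negbK; apply/eqP/trmx_inj; rewrite trmx0.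
  by apply: (row_full_inj Xf); rewrite mul_row0_tr Xb mulmx0.
have [i Ai] : exists i, row i (rsubmx A) *m b^T != 0.
  apply/existsP; apply: contraR Ab => /existsPn H; apply/eqP/row_matrixP => i.
  by rewrite row_mul row0; apply/eqP/negPn/H.
exists (row i (rsubmx A)) => //; apply/andP; split; last exact: row_sub.
apply/row_subP => j; pose c (u : 'rV[K]_l) := (u *m b^T) 0 0.
have ci0 : c (row i (rsubmx A)) != 0.
  apply: contra Ai => /eqP ci; apply/eqP/matrixP => i' j'.
  by rewrite !ord1 [RHS]mxE.
(* the multiple of row i whose difference with row j lies in X *)
pose t := c (row j (rsubmx A)) / c (row i (rsubmx A)).
have rr u : rsubmx (row u A) = row u (rsubmx A) by apply/rowP => ?; rewrite !mxE.
have h0 : (row j A - t *: row i A <= A :&: X)%MS.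
  rewrite sub_capmx; apply/andP; split.
    by rewrite addmx_sub ?row_sub// eqmx_opp scalemx_sub ?row_sub.
  apply: submx_trans kX; rewrite sub_kermx mul_row0_tr; apply/eqP/matrixP => i' j'.
  have lc (P Q : 'M[K]_1) : (P - t *: Q) 0 0 = P 0 0 - t * Q 0 0 by rewrite !mxE.
  rewrite !ord1 linearB linearZ/= mulmxBl -scalemxAl lc !rr [RHS]mxE.
  by rewrite -/(c _) -/(c (row i _)) /t divfK// subrr.
have := submx_trans h0 AXk; rewrite sub_pid_rsubmx linearB linearZ/= subr_eq0.
by rewrite !rr => /eqP->; rewrite scalemx_sub.
Qed.

(** Covectors transform by the transpose of a linear map T of the vectors. *)
Lemma kermx_tr_transfer n l (Y Z : 'M[K]_(n, l)) (T : 'M[K]_l) : T \in unitmx ->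
  (Z == Y *m T)%MS -> (kermx Y^T == kermx Z^T *m T^T)%MS.
Proof.
move=> Tu /andP[/submxP[D ZE] /submxP[D' YE]]; have Tu' : T^T \in unitmx by rewrite unitmx_tr.
apply/andP; split; last first.
  by rewrite sub_kermx -mulmxA -trmx_mul YE trmx_mul mulmxA mulmx_ker mul0mx.
rewrite -[kermx Y^T](mulmxKV Tu'); apply: submxMr.
by rewrite sub_kermx ZE !trmx_mul !mulmxA mulmxKV// mulmx_ker mul0mx.
Qed.

Lemma nonzero_rV_transitive n (v w : 'rV[K]_n) : v != 0 -> w != 0 ->
  exists2 g : 'M[K]_n, g \in unitmx & (w *m g == v)%MS.
Proof.
have eb (u : 'rV[K]_n) : u != 0 -> (u :=: (pid_mx 1 : 'rV[K]_n) *m row_ebase u)%MS.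
  move=> u0; rewrite -{1}(mulmx_ebase u) rank_rV u0 -mulmxA; apply: eqmxMfull.
  by rewrite row_full_unit col_ebase_unit.
move=> v0 w0; exists (invmx (row_ebase w) *m row_ebase v).
  by rewrite unitmx_mul unitmx_inv !row_ebase_unit.
apply/eqmxP; apply: eqmx_trans (eqmx_sym (eb _ v0)).
apply: eqmx_trans (eqmxMr _ (eb _ w0)) _.
by rewrite mulmxA mulmxK ?row_ebase_unit.
Qed.

End covectors.

Section affine.
Variables (R : realType) (k : nat).
Implicit Types (s : 'rV[R]_k) (h : 'M[R]_k.+1).

(** The linear form of which the hyperplane at infinity is the kernel; it is
    written as a row vector, to be paired with points by the transpose. *)
Definition infinity : 'rV[R]_k.+1 := affine_incl 0.

Lemma affine_incl_infinity s : affine_incl s *m infinity^T = 1%:M.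
Proof.
rewrite /infinity /affine_incl.
by rewrite -[LHS]/((row_mx 1%:M s : 'rV[R]_(1 + k)) *m (row_mx 1%:M 0 : 'rV[R]_(1 + k))^T)
  tr_row_mx mul_row_col trmx1 mulmx1 trmx0 mulmx0 addr0.
Qed.

(** A projective transformation that preserves the form [infinity] up to scale
    has a block triangular matrix. *)
Lemma affine_of_projective h (b : R) : h \in unitmx ->
  h *m infinity^T = b *: infinity^T ->
  exists (g : 'M[R]_k) (v : 'rV[R]_k), g \in unitmx /\
    forall s s', (affine_incl s' == affine_incl s *m h)%MS -> s' = s *m g + v.
Proof.
move=> hu hb; pose h' : 'M[R]_(1 + k) := h.
have : h' *m (row_mx 1%:M 0 : 'rV[R]_(1 + k))^T = b *: (row_mx 1%:M 0 : 'rV[R]_(1 + k))^T.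
  exact: hb.
rewrite tr_row_mx trmx1 trmx0 -{1}[h']submxK mul_block_col !mulmx1 !mulmx0 !addr0.
rewrite scale_col_mx scaler0 => /eq_col_mx[hul hdl].
have : h' \in unitmx by exact: hu.
rewrite -[h']submxK hul hdl unitmxE det_ublock unitrM -!unitmxE => /andP[bu gu].
have b0 : b != 0.
  by move: bu; rewrite scale_scalar_mx mulr1 unitmxE det_scalar1 unitfE.
exists (b^-1 *: drsubmx h'), (b^-1 *: ursubmx h'); split.
  by rewrite unitmxZ// unitfE invr_eq0.
move=> s s' /andP[/sub_rVP[c]].
rewrite /affine_incl => E _.
have : (row_mx 1%:M s' : 'rV[R]_(1 + k)) =
    c *: ((row_mx 1%:M s : 'rV[R]_(1 + k)) *m h') by exact: E.
rewrite -[h']submxK hul hdl mul_row_block mulmx0 addr0 !mul1mx scale_row_mx.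
move=> /eq_row_mx[cb ->].
have -> : c = b^-1.
  move/matrixP/(_ 0 0): cb; rewrite !mxE eqxx /= mulr1 => cb.
  by apply: (mulIf b0); rewrite mulVf//; exact: esym cb.
by rewrite scalerDr scalemxAr addrC ?block_mxKur ?block_mxKdr.
Qed.

End affine.

(** * The covector of the contact hyperplane *)

Section contact.
Variables (R : realType) (k : nat) (M : manifold R (k + k.+1)).
Variables (xi F : subspace_field M).
Let G := intersect_field F xi.

(** beta consists of the last components of a contact form alpha, whose first
    components vanish because xi contains the tangent spaces of the plaques.
    The last clause says that the class of beta in projective space is an
    immersion on the plaques: otherwise (u, 0) would be in the kernel of
    d alpha on xi. *)
Lemma contact_covector c x :
  contact_structure xi -> co_legendrian xi F -> foliated_chart k G c -> dom c x ->
  exists (U : set 'rV[R]_(k + k.+1)) (beta : 'rV[R]_(k + k.+1) -> 'rV[R]_k.+1),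
    [/\ open U, U (c x), forall r, Ck r U beta &
    forall p, U p ->
      [/\ (c @` dom c) p, (phi_line xi c (ch_inv c p) == beta p)%MS,
          exists2 v : 'rV[R]_k.+1, (rsubmx (F c (ch_inv c p)) == v)%MS &
            v *m (beta p)^T != 0 &
          forall (u : 'rV[R]_k) (b : R),
            'D_(row_mx u 0) beta p = b *: beta p -> u = 0]].
Proof.
move=> [_ hxi] [_ hT _] [ac _ Gc] cx; have [cc _] := ac.
have [U [alpha [oU Ux Uc /smooth_onP Ca hU]]] := hxi c x ac cx.
pose beta := rsubmx \o alpha : 'rV[R]_(k + k.+1) -> 'rV[R]_k.+1.
exists U, beta.
have lalpha p : U p -> lsubmx (alpha p) = 0.
  move=> Up; have [_ xiE _] := hU p Up; have [y cy yp] := Uc p Up.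
  move: xiE; rewrite -yp chartK// yp => /andP[xia _].
  apply/trmx_inj; rewrite trmx0; apply/row_matrixP => i; rewrite row0.
  have : (row_mx (delta_mx 0 i) 0 : 'rV[R]_(k + k.+1)) *m (alpha p)^T = 0.
    apply/eqP; rewrite -sub_kermx; apply: submx_trans xia.
    apply: (@submx_trans _ _ _ _ _ _ (G c y)); last exact: capmxSr.
    by rewrite (eqmxP (Gc y cy)) sub_pid_rsubmx row_mxKr.
  by rewrite -{1}[alpha p]hsubmxK tr_row_mx mul_row_col mul0mx addr0 -rowE.
have aE p : U p -> alpha p = row_mx 0 (beta p).
  by move=> Up; rewrite -[LHS]hsubmxK lalpha.
have da p : U p -> differentiable alpha p by have [d _] := Ca 1%N; apply: d.
have Da p u : U p -> 'D_u alpha p = row_mx 0 ('D_u beta p).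
  move=> Up; rewrite -[LHS]hsubmxK; congr row_mx.
    rewrite -(derive_lin u (@continuous_lsubmx _ 1 k k.+1) (da p Up)).
    rewrite -[RHS](derive_cst (0 : 'rV[R]_k) p u); apply: near_eq_derive.
    by apply: (open_near_eq oU Up) => q Uq /=; rewrite lalpha.
  by rewrite -(derive_lin u (@continuous_rsubmx _ 1 k k.+1) (da p Up)).
split=> // [r|p Up].
  exact: (Ck_comp_lin oU (@continuous_rsubmx _ 1 k k.+1) (Ca r)).
have [a0 xiE nd] := hU p Up; have [y cy yp] := Uc p Up.
have b0 : beta p != 0.
  by apply: contra a0 => /eqP b0; rewrite aE// b0 row_mx0.
rewrite aE// in xiE.
split; first by exists y.
- exact: annihilator_rsubmx xiE.
- have yE : ch_inv c p = y by rewrite -yp chartK.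
  apply: (line_rsubmx b0 xiE); rewrite yE; first exact: hT.
  by have /andP[] := Gc y cy.
move=> u b Dbeta.
suff : (row_mx u 0 : 'rV[R]_(k + k.+1)) = 0.
  by move=> /(congr1 lsubmx); rewrite row_mxKl linear0.
apply: nd; first by rewrite aE// mul_row0_tr row_mxKr mul0mx.
move=> v va; rewrite /ext_deriv !Da// Dbeta !mul_row0_tr row_mxKr mul0mx subr0.
have vb : rsubmx v *m (beta p)^T = 0 by rewrite -mul_row0_tr -aE.
by rewrite linearZ/= -scalemxAr vb scaler0.
Qed.

End contact.

(** * Normalizing homogeneous coordinates *)

Section normalization.
Variables (R : realType) (k : nat).
Implicit Type w : 'rV[R]_k.+1.

Definition pairing_infinity w : R := (w *m (infinity R k)^T) 0 0.

(** The inverse of [affine_incl] on the points that are not at infinity. *)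
Definition to_affine w : 'rV[R]_k :=
  (pairing_infinity w)^-1 *: rsubmx (w : 'rV[R]_(1 + k)).

Lemma affine_incl_to_affine w : pairing_infinity w != 0 ->
  affine_incl (to_affine w) = (pairing_infinity w)^-1 *: w.
Proof.
move=> z0; pose v : 'rV[R]_(1 + k) := w.
have lE : v *m (row_mx 1%:M 0 : 'rV[R]_(1 + k))^T = lsubmx v.
  by rewrite -{1}[v]hsubmxK tr_row_mx mul_row_col trmx1 mulmx1 trmx0 mulmx0 addr0.
have lv : lsubmx v = (pairing_infinity w)%:M by rewrite -lE [LHS]mx11_scalar.
suff : row_mx 1%:M (to_affine w) = (pairing_infinity w)^-1 *: v by [].
by rewrite -[v]hsubmxK scale_row_mx lv scale_scalar_mx mulVf.
Qed.

Lemma Ck_pairing_infinity (V : normedModType R) r (S : set V) (w : V -> 'rV[R]_k.+1) :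
  open S -> Ck r S w -> Ck r S (fun s => pairing_infinity (w s)).
Proof.
move=> oS Cw; apply: (Ck_coord (f := fun s => w s *m (infinity R k)^T)) => //.
by apply: Ck_mulmx => //; exact: Ck_cst.
Qed.

Lemma Ck_to_affine (V : normedModType R) r (S : set V) (w : V -> 'rV[R]_k.+1) :
  open S -> (forall s, S s -> pairing_infinity (w s) != 0) ->
  Ck r S w -> Ck r S (fun s => to_affine (w s)).
Proof.
move=> oS w0 Cw; apply: Ck_mx => // i j.
have C1 := Ck_inv oS w0 (Ck_pairing_infinity oS Cw).
have C2 := Ck_comp_lin oS (@continuous_rsubmx _ 1 1 k) Cw.
have := Ck_mul oS C1 (Ck_coord i j oS C2).
by apply: Ck_congr => // s _; rewrite /to_affine [RHS]mxE.
Qed.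

(** Each coordinate of w divided by the same function z = [pairing_infinity] w
    has zero derivative, so all coordinates of w have the same logarithmic
    derivative as z. *)
Lemma derive_to_affine_eq0 (V : normedModType R) (S : set V) (w : V -> 'rV[R]_k.+1) s u :
  open S -> S s -> (forall s, S s -> pairing_infinity (w s) != 0) -> Ck 1 S w ->
  'D_u (fun s => to_affine (w s)) s = 0 -> exists b, 'D_u w s = b *: w s.
Proof.
move=> oS Ss w0 Cw Dw.
pose z s := pairing_infinity (w s).
have Cz := Ck_inv oS w0 (Ck_pairing_infinity oS Cw).
have [/(_ s Ss)/(diff_derivable (v := u)) dz _] := Cz.
have [/(_ s Ss)/(diff_derivable (v := u)) dw _] := Cw.
have [/(_ s Ss)/(diff_derivable (v := u)) dt _] := Ck_to_affine oS w0 Cw.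
exists (- z s * 'D_u (fun s => (z s)^-1) s); apply/rowP => j.
rewrite derive_mx// [LHS]mxE [RHS]mxE.
have dwj : derivable (fun s => w s 0 j) s u by exact: ((derivable_mxP _ _ _).1 dw).
(* The coordinates of w / z are the constant 1 and those of to_affine w. *)
have D0 : 'D_u (fun s => (z s)^-1 * w s 0 j) s = 0.
  rewrite (_ : 'D_u _ s =
    'D_u (fun s => affine_incl (to_affine (w s)) 0 j) s); last first.
    apply: near_eq_derive; apply: (open_near_eq oS Ss) => y Sy.
    by rewrite affine_incl_to_affine ?w0// mxE.
  have [i ->|i ->] := @split_ordP 1 k j.
    rewrite -[RHS](derive_cst ((1%:M : 'M[R]_1) 0 i) s u); congr ('D_u _ s).
    by apply/funext => y; exact: row_mxEl.
  have -> : (fun s => affine_incl (to_affine (w s)) 0 (rshift 1 i)) =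
      (fun s => to_affine (w s) 0 i).
    by apply/funext => y; exact: row_mxEr.
  by move/rowP/(_ i): Dw; rewrite derive_mx// !mxE.
have := deriveM dz dwj; rewrite [LHS]D0 => /esym/eqP.
rewrite addr_eq0 => /eqP E.
have z0 : z s != 0 by exact: w0.
apply: (mulfI (invr_neq0 z0)); apply: (etrans E).
by rewrite /GRing.scale/=; field.
Qed.

Lemma derive_row_mx l (t : 'rV[R]_l) (s u : 'rV[R]_k) :
  'D_u (fun s => row_mx s t : 'rV[R]_(k + l)) s = row_mx u 0.
Proof.
pose L : {linear 'rV[R]_k -> 'rV[R]_(k + l)} := mulmxr (row_mx 1%:M 0).
have cL : continuous L by exact: mulmx_continuous.
have did : differentiable (@id 'rV[R]_k) s by exact: (@ex_diff _ _ _ _ _ _ _ (is_diff_id s)).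
have dL : derivable (L \o id) s u.
  by apply: diff_derivable; apply: differentiable_comp => //; exact: linear_differentiable.
have dc : derivable (cst (row_mx 0 t : 'rV[R]_(k + l))) s u by exact: derivable_cst.
have := deriveD dL dc; rewrite derive_lin// derive_id derive_cst addr0.
have -> : L \o id + cst (row_mx 0 t) = (fun s => row_mx s t : 'rV[R]_(k + l)).
  apply/funext => y; rewrite !fctE /=.
  by rewrite mul_mx_row mulmx1 mulmx0 add_row_mx addr0 add0r.
by move=> ->; rewrite /= mul_mx_row mulmx1 mulmx0.
Qed.

End normalization.

(** * Affine charts of the leaves *)

Section adapted.
Variables (R : realType) (k : nat) (M : manifold R (k + k.+1)).
Variables (xi F : subspace_field M).
Hypotheses (hxi : contact_structure xi) (hF : co_legendrian xi F).
Let G := intersect_field F xi.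
Let fF : foliation k.+1 F. Proof. by case: hF. Qed.
Let fG : foliation k G. Proof. by case: hF. Qed.

(** Besides agreeing with the map phi up to the projective transformation g,
    the chart a sends the covectors vanishing on the line dp(F_x) to infinity.
    This singles out the affine charts among the projective ones, and it makes
    sense for all foliated charts c simultaneously. *)
Definition adapted (a : chart R M k) : Prop :=
  forall c x, foliated_chart k G c -> dom c x -> dom a x ->
    let e := plaque_chart c (leaf_proj c x) in
    exists g : 'M[R]_k.+1,
      [/\ g \in unitmx, (infinity R k *m g^T == rsubmx (F c x))%MS &
          \forall s \near e x,
            (affine_incl (a (ch_inv e s)) == phi_line xi c (ch_inv e s) *m g)%MS].

Lemma infinity_neq0 : infinity R k != 0.
Proof.
apply/eqP => i0; have := affine_incl_infinity (0 : 'rV[R]_k).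
rewrite i0 trmx0 mulmx0 => /matrixP/(_ 0 0)/eqP.
by rewrite !mxE eq_sym oner_eq0.
Qed.

Lemma plaque_transition_field (D : subspace_field M) c d y (T : 'M[R]_k.+1) :
  is_subspace_field D -> admissible (atlas M) c -> admissible (atlas M) d ->
  dom c y -> dom d y ->
  (forall n (X : 'M[R]_(n, k + k.+1)),
     rsubmx (X *m 'J (d \o ch_inv c) (c y)) = rsubmx X *m T) ->
  (rsubmx (D d y) == rsubmx (D c y) *m T)%MS.
Proof.
move=> fD ac ad cy dy H; rewrite -H.
by apply: rsubmx_eqmx; exact: fD.
Qed.

(** Near x0 the covector beta, followed by a linear map that sends the form
    of pairing with the line dp(F) to [infinity], avoids infinity, and its
    affine coordinates psi are the required chart of the plaque. *)
Lemma exists_adapted x0 : exists a : chart R M k,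
  [/\ admissible (plaque_atlas G) a, dom a x0, dom a `<=` leaf G x0 & adapted a].
Proof.
have [sF _] := fF; have [sG chG] := fG; have [sxi _] := hxi.
have [c Gc cx0] := chG x0; have [ac _ _] := Gc; have [cc _] := ac.
have [U [beta [oU Ux0 Cbeta hU]]] := contact_covector hxi hF Gc cx0.
have GF y : dom c y -> (G c y <= F c y)%MS by move=> _; exact: capmxSl.
have rk : (k.+1 <= k + k.+1)%N by exact: leq_addl.
have [r0 r00 hr0] := foliation_constant_along_plaque rk fF Gc GF cx0.
set t0 := rsubmx (c x0); set s0 := lsubmx (c x0).
have p0E : row_mx s0 t0 = c x0 by exact: hsubmxK.
have [_ _ [v Fv vb0] _] := hU _ Ux0.
rewrite (chartK cc cx0) in Fv.
have v0 : v != 0 by apply: contra vb0 => /eqP->; rewrite mul0mx.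
(* v spans the image of F, so beta p is mapped to infinity by h^T exactly when
   it vanishes on this line. *)
have [h hu hv] := nonzero_rV_transitive v0 infinity_neq0.
pose S : set 'rV[R]_k := [set s | (U `&` ball (c x0) r0) (row_mx s t0)].
have oS : open S by apply: open_slice; apply: openI => //; exact: ball_open.
have Ss0 : S s0 by rewrite /S /= p0E; split=> //; exact: ballxx.
have SF s : S s -> (rsubmx (F c (ch_inv c (row_mx s t0))) == v)%MS.
  move=> [_ /hr0[_ Fs]]; have {}Fs := Fs (row_mxKr _ _).
  by apply/eqmxP/(eqmx_trans (eqmxP (rsubmx_eqmx Fs)))/eqmxP.
pose w s := beta (row_mx s t0) *m h^T.
have w0 s : S s -> pairing_infinity (w s) != 0.
  move=> Ss; have [Us _] := Ss; have [_ _ [v' Fv' v'b] _] := hU _ Us.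
  apply: contra v'b => /eqP w0.
  have /submxP[D ->] : (v' <= infinity R k *m h)%MS.
    rewrite (eqmxP hv) -(eqmxP (SF s Ss)); by have /andP[] := Fv'.
  rewrite -mulmxA.
  have -> : infinity R k *m h *m (beta (row_mx s t0))^T = (w s *m (infinity R k)^T)^T.
    by rewrite /w !trmx_mul !trmxK mulmxA.
  by rewrite [w s *m _]mx11_scalar [X in X%:M]w0 -scalemx1 scale0r trmx0 mulmx0.
have Cw r : Ck r S w.
  have CS := Ck_comp oS oU (fun s (Ss : S s) => Ss.1)
    (Ck_sub (@subsetT _ S) (@Ck_row_mx R k k.+1 r t0)) (Cbeta r).
  by apply: Ck_mulmx => //; exact: Ck_cst.
pose psi s := to_affine (w s).
have Cpsi r : Ck r S psi by exact: Ck_to_affine.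
have imm u : 'D_u psi s0 = 0 -> u = 0.
  move=> /(derive_to_affine_eq0 oS Ss0 w0 (Cw 1%N))[b Db].
  have [_ _ _ nd] := hU _ Ux0; apply: (nd _ b).
  have hTu : h^T \in unitmx by rewrite unitmx_tr.
  have drow : differentiable (fun s => row_mx s t0 : 'rV[R]_(k + k.+1)) s0.
    by have [d _] := @Ck_row_mx R k k.+1 1 t0; exact: d.
  have dbeta : differentiable beta (row_mx s0 t0).
    by rewrite p0E; have [d _] := Cbeta 1%N; exact: d.
  have E := derive_comp u drow dbeta.
  rewrite derive_row_mx p0E in E.
  rewrite -E; apply: (can_inj (mulmxK hTu)).
  have Dw := derive_lin u (@mulmx_continuous _ 1 k.+1 k.+1 h^T)
    (differentiable_comp drow dbeta).
  by rewrite -scalemxAl -p0E -[LHS]Dw -[RHS]Db.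
have [W [theta [oW Ws0 WS [thetaK oimg Ctheta]]]] := inverse_function oS Ss0 Cpsi imm.
set e := plaque_chart c t0.
have ae : admissible (plaque_atlas G) e by exact: plaque_admissible.
have We : W `<=` e @` dom e.
  rewrite plaque_image// => s /WS[Us _]; by have [] := hU _ Us.
have aa := admissible_comp (@plaque_atlas_chart _ _ _ _ ) ae oW We thetaK oimg
  (fun r => Ck_sub WS (Cpsi r)) Ctheta.
set a := Chart _ _ _ in aa.
exists a; split=> //.
- by move=> y [[cy yt] _]; apply: rt_step; exists c.
move=> c' x Gc' c'x [[cx xt] Wx] e'.
have [ac' _ _] := Gc'; have [cc' _] := ac'.
have [r [T [r_gt0 Tu hT]]] := plaque_transition sG Gc' Gc c'x cx.
have TTu : T^T \in unitmx by rewrite unitmx_tr.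
have e'x : row_mx (e' x) (rsubmx (c' x)) = c' x by exact: hsubmxK.
have Jx : forall n (X : 'M[R]_(n, k + k.+1)),
    rsubmx (X *m 'J (c \o ch_inv c') (c' x)) = rsubmx X *m T.
  by have [] := hT _ (ballxx _ r_gt0) erefl.
exists (invmx T^T *m h^T); split.
- by rewrite unitmx_mul unitmx_inv TTu unitmx_tr.
- rewrite trmx_mul trmxK trmx_inv trmxK mulmxA.
  have FT := plaque_transition_field sF ac' ac c'x cx Jx.
  have Fx : (rsubmx (F c x) == v)%MS.
    have := SF _ (WS _ Wx); rewrite -[t0]xt.
    by rewrite /e /= /leaf_proj hsubmxK chartK.
  have hF' : (infinity R k *m h == rsubmx (F c' x) *m T)%MS.
    apply/eqmxP/(eqmx_trans (eqmxP hv)).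
    by apply: (eqmx_trans (eqmx_sym (eqmxP Fx))); exact/eqmxP.
  by apply/eqmxP/(eqmx_trans (eqmxMr _ (eqmxP hF'))); rewrite mulmxK.
(* Near x the plaque of c' lies in the domain of a and in the ball where the
   differential T of the map between the leaf spaces is constant. *)
have oN : open [set s : 'rV[R]_k | ball (c' x) r (row_mx s (rsubmx (c' x)))].
  by apply: open_slice; exact: ball_open.
have Nx : ball (c' x) r (row_mx (e' x) (rsubmx (c' x))).
  by rewrite e'x; exact: ballxx.
have [_ [oea _]] : smooth_transition a e' /\ smooth_transition e' a.
  by apply: aa.2; exists c', (leaf_proj c' x).
have eax : (e' @` (dom e' `&` dom a)) (e' x) by exists x.
apply: filterS2 (open_nbhs_nbhs (conj oN Nx)) (open_nbhs_nbhs (conj oea eax)).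
move=> s By [y [[c'y yx] ay] ys]; move: By; rewrite -{}ys => By.
have ch : is_chart e' by exact: plaque_is_chart.
rewrite (chartK ch (conj c'y yx)).
have yE : row_mx (e' y) (rsubmx (c' x)) = c' y.
  by rewrite -[rsubmx (c' x)]yx; exact: hsubmxK.
rewrite /= in By; rewrite yE in By.
have [[cy yt] Wy] := ay.
have [_ _ Jy] := hT _ By yx.
have XT := plaque_transition_field sxi ac' ac c'y cy Jy.
have phiT := kermx_tr_transfer Tu XT.
have cyE : row_mx (e y) t0 = c y by rewrite -yt; exact: hsubmxK.
have Uy : U (c y) by rewrite -cyE; have [] := WS _ Wy.
have [_ phib _ _] := hU _ Uy; rewrite chartK// in phib.
have wy0 := w0 _ (WS _ Wy).
have aE : affine_incl (a y) = (pairing_infinity (w (e y)))^-1 *: w (e y).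
  exact: affine_incl_to_affine.
rewrite aE; apply/eqmxP.
apply: (eqmx_trans (eqmx_scale _ _)); first by rewrite invr_eq0.
rewrite /w cyE mulmxA; apply: eqmxMr.
apply: (eqmx_trans (eqmx_sym (eqmxP phib))); apply/eqmx_sym.
apply: (eqmx_trans (eqmxMr _ (eqmxP phiT))).
by rewrite mulmxK.
Qed.

End adapted.

(** * The affine structure *)

Section structure.
Variables (R : realType) (k : nat) (M : manifold R (k + k.+1)).
Variables (xi F : subspace_field M).
Let G := intersect_field F xi.

Lemma affine_incl_inj (s s' : 'rV[R]_k) :
  (affine_incl s == affine_incl s')%MS -> s = s'.
Proof.
move=> /andP[/sub_rVP[c E] _].
have c1 : c = 1.
  have := congr1 (fun w => (w *m (infinity R k)^T) 0 0) E.
  by rewrite -scalemxAl !affine_incl_infinity !mxE mulr1 => /esym.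
move: E; rewrite c1 scale1r => E.
by have /eq_row_mx[_] : (row_mx 1%:M s : 'rV[R]_(1 + k)) = row_mx 1%:M s' by exact: E.
Qed.

(** Both charts are compared with phi in one foliated chart c.  As both send
    the annihilator of dp(F_x) to infinity, the projective transformation h
    between them preserves the hyperplane at infinity. *)
Lemma adapted_transition (a b : chart R M k) x :
  is_subspace_field G -> (forall x, exists2 c, foliated_chart k G c & dom c x) ->
  admissible (plaque_atlas G) a -> adapted xi F a -> adapted xi F b ->
  dom a x -> dom b x ->
  exists (g : 'M[R]_k) (v : 'rV[R]_k), g \in unitmx /\
    \forall s \near a x, b (ch_inv a s) = s *m g + v.
Proof.
move=> sG chG aa fa fb ax bx; have [c Gc cx] := chG x.
have [ca _] := aa; have [ac _ _] := Gc.
pose e := plaque_chart c (leaf_proj c x).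
have ch : is_chart e by exact: plaque_is_chart.
have ex : dom e x by [].
have [ga [gau Fa na]] := fa c x Gc cx ax.
have [gb [gbu Fb nb]] := fb c x Gc cx bx.
pose h := invmx ga *m gb.
have hu : h \in unitmx by rewrite unitmx_mul unitmx_inv gau.
have [l hl] : exists l, h *m (infinity R k)^T = l *: (infinity R k)^T.
  have /sub_rVP[l lE] : (infinity R k *m gb^T <= infinity R k *m ga^T)%MS.
    by rewrite (eqmxP Fb) -(eqmxP Fa).
  exists l; apply: trmx_inj; rewrite linearZ/= trmx_mul !trmxK /h trmx_mul mulmxA lE.
  by rewrite trmx_inv -scalemxAl mulmxK// unitmx_tr.
have [g [v [gu gE]]] := affine_of_projective hu hl.
exists g, v; split=> //.
have [[oae sae] _] : smooth_transition a e /\ smooth_transition e a.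
  by apply: aa.2; exists c, (leaf_proj c x).
have aex : (a @` (dom a `&` dom e)) (a x) by exists x.
have cae : {for a x, continuous (e \o ch_inv a)} by exact: (sae 0%N).
have eax : (e \o ch_inv a) (a x) = e x by rewrite /= (chartK ca ax).
rewrite /prop_for /continuous_at eax in cae.
apply: filterS3 (open_nbhs_nbhs (conj oae aex)) (cae _ na) (cae _ nb).
move=> s [y [ay ey] <-] /=; rewrite (chartK ca ay).
have -> : ch_inv c (row_mx (lsubmx (c y)) (leaf_proj c x)) = y by exact: (chartK ch ey).
move=> aE bE; apply: gE; apply/eqmxP; apply: (eqmx_trans (eqmxP bE)).
rewrite /h mulmxA; apply: eqmxMr; apply/eqmx_sym.
by apply: (eqmx_trans (eqmxMr _ (eqmxP aE))); rewrite mulmxK.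
Qed.

End structure.

Theorem lemma2p4 (R : realType) (k : nat) (M : manifold R (k + k.+1))
    (xi F : subspace_field M)
    (hxi : contact_structure xi)
    (hF : co_legendrian xi F) :
  let G := intersect_field F xi in
  forall x : M,
    reduces_to_affine G (leaf G x) (canonical_proj_structure xi G (leaf G x)).
Proof.
move=> G x; have [_ _ [sG chG]] := hF.
exists [set a | leaf_chart G (leaf G x) a /\ adapted xi F a].
  split=> [a [] //|y Ly|a b y [[aa _] fa] [_ fb] ay by_].
    have [a [aa ay aL fa]] := exists_adapted hxi hF y; exists a => //.
    by split=> //; split=> // z /aL; exact: rt_trans Ly.
  exact: (adapted_transition sG chG aa fa fb ay by_).
move=> a [[aa aL] fa]; have [ca _] := aa; split.
  split=> //= [y ay|y z ay az yz|y ay].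
  - apply/eqP => a0; have := affine_incl_infinity (a y).
    by rewrite a0 mul0mx => /matrixP/(_ 0 0)/eqP; rewrite !mxE eq_sym oner_eq0.
  - exact: (chart_inj ca ay az (affine_incl_inj yz)).
  - exists a, 1%:M; split=> //; first exact: unitmx1.
    by move=> z az; rewrite mulmx1 submx_refl.
move=> c y Gc cy ay e; have [g [gu _ ng]] := fa c y Gc cy ay.
by exists g.
Qed.
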